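(* Let $\{X_k\}_{k\ge0}$ be a stationary, finite-state, irreducible, time-homogeneous Markov chain (periodicity is allowed) with invariant distribution $\pi$, let $r$ be an $\mathbb R^d$-valued function on the state space, $\bar r:=\pi r$, and $$U_n=\frac1{\sqrt n}\sum_{k=1}^n\bigl(r(X_{k-1})-\bar r\bigr).$$ Let $\Sigma_\infty$ be the asymptotic covariance matrix defined in the context and assume $\Sigma_\infty\succ0$. Let $Z\sim N(0,I)$ in $\mathbb R^d$. Then there is a constant $C$, not depending on $n$ or $\beta$, such that for every $\beta\in(0,1)$ and every $n\ge1$, $$d_{\mathcal W}(U_n,\Sigma_\infty^{1/2}Z)\le\frac{C}{(1-\beta)^2}\,n^{-\beta/2}.$$ Consequently, as $n\to\infty$, $$d_{\mathcal W}(U_n,\Sigma_\infty^{1/2}Z)=O\left(\frac{(\log n)^2}{\sqrt n}\right).$$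
   Context: The Wasserstein distance between $\mathbb R^d$-valued random vectors is $d_{\mathcal W}(X,Y)=\sup_{h\in Lip_1}E[h(X)-h(Y)]$, where $Lip_1$ is the set of functions $h:\mathbb R^d\to\mathbb R$ with $|h(x)-h(y)|\le\|x-y\|$ (Euclidean norm). Let $P$ be the transition matrix, acting on functions by $Pf(x)=E[f(X_1)\mid X_0=x]$, and $\pi f=\sum_x\pi(x)f(x)$ (componentwise for vector- and matrix-valued $f$). Let $V$ (an $\mathbb R^d$-valued function on the state space) solve the Poisson equation $V-PV=r-\bar r$. Put $m_k:=V(X_k)-E[V(X_k)\mid X_{k-1}]$, a martingale difference sequence with respect to $\mathcal F_k=\sigma(X_0,\dots,X_k)$, and $v(x):=E[m_1m_1^\top\mid X_0=x]$. The asymptotic covariance is $\Sigma_\infty:=\pi(v)$, which in stationarity equals $E(\Sigma_k)$ with $\Sigma_k:=E[m_km_k^\top\mid\mathcal F_{k-1}]=v(X_{k-1})$. *)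

(* Defs.v *)
From HB Require Import structures.
From mathcomp Require Import all_boot all_order all_algebra.
From mathcomp Require Import all_classical all_reals all_analysis.

Set Implicit Arguments.
Unset Strict Implicit.
Unset Printing Implicit Defensive.
Import Order.TTheory GRing.Theory Num.Theory.
Import numFieldNormedType.Exports.

Local Open Scope classical_set_scope.
Local Open Scope ring_scope.

(* The norm of the normed module ['cV[R]_d] is the sup norm, so the Euclidean
   norm has to be written out. *)
Definition enorm (R : realType) (d : nat) (x : 'cV[R]_d) : R :=
  Num.sqrt (\sum_(i < d) x i 0 ^+ 2).

Definition lip1 (R : realType) (d : nat) : set ('cV[R]_d -> R) :=
  [set h | forall x y, `|h x - h y| <= enorm (x - y)].

(* The two vectors may live on different probability spaces, hence the
   difference of expectations instead of the expectation of a difference. *)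
Definition wasserstein (R : realType) (d : nat)
    (d1 : measure_display) (T1 : measurableType d1) (P1 : probability T1 R)
    (X : T1 -> 'cV[R]_d)
    (d2 : measure_display) (T2 : measurableType d2) (P2 : probability T2 R)
    (Y : T2 -> 'cV[R]_d) : \bar R :=
  ereal_sup [set ('E_P1[h \o X] - 'E_P2[h \o Y])%E | h in @lip1 R d].

(* Z ~ N(0, I): the law of Z is the d-fold product of N(0, 1). *)
Definition std_gaussian (R : realType) (d : nat)
    (disp : measure_display) (T : measurableType disp) (P : probability T R)
    (Z : T -> 'cV[R]_d) : Prop :=
  (forall i, measurable_fun setT (fun w => Z w i 0)) /\
  forall A : 'I_d -> set R, (forall i, measurable (A i)) ->
    P [set w | forall i, A i (Z w i 0)] =
      (\prod_(i < d) normal_prob 0 1 (A i))%E.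

Definition psdmx (R : realType) (d : nat) (A : 'M[R]_d) : Prop :=
  A^T = A /\ forall x : 'cV[R]_d, 0 <= (x^T *m A *m x) 0 0.

Definition pdmx (R : realType) (d : nat) (A : 'M[R]_d) : Prop :=
  A^T = A /\ forall x : 'cV[R]_d, x != 0 -> 0 < (x^T *m A *m x) 0 0.

(* B = A^{1/2}, the unique positive semidefinite square root of A. *)
Definition is_sqrtmx (R : realType) (d : nat) (A B : 'M[R]_d) : Prop :=
  psdmx B /\ B *m B = A.

Section Chain.
Context (R : realType) (S : finType).
Implicit Types (p : S -> S -> R) (pi : S -> R).

Definition stochastic p : Prop :=
  (forall x y, 0 <= p x y) /\ forall x, \sum_y p x y = 1.

Fixpoint nstep p (n : nat) (x y : S) : R :=
  if n is m.+1 then \sum_z p x z * nstep p m z y else (x == y)%:R.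

Definition irreducible p : Prop := forall x y, exists n, 0 < nstep p n x y.

Definition invariant_distribution p pi : Prop :=
  [/\ forall x, 0 <= pi x, \sum_x pi x = 1
    & forall y, \sum_x pi x * p x y = pi y].

Definition transition_op p (m n : nat) (f : S -> 'M[R]_(m, n)) (x : S) :
  'M[R]_(m, n) := \sum_y p x y *: f y.

Definition state_mean pi (m n : nat) (f : S -> 'M[R]_(m, n)) : 'M[R]_(m, n) :=
  \sum_x pi x *: f x.

Definition poisson_solution p pi (d : nat) (r V : S -> 'cV[R]_d) : Prop :=
  forall x, V x - transition_op p V x = r x - state_mean pi r.

Context (disp : measure_display) (T : measurableType disp).
Context (P : probability T R) (X : nat -> T -> S).

Definition history (n : nat) (x : nat -> S) : set T :=
  [set w | forall k, (k <= n)%N -> X k w = x k].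

Definition cond_prob (A B : set T) : R := fine (P (A `&` B)) / fine (P B).

(* E[W | B] for an event B of positive probability, entrywise. *)
Definition cond_mean (m n : nat) (W : T -> 'M[R]_(m, n)) (B : set T) :
    'M[R]_(m, n) :=
  \matrix_(i, j) ((\int[P]_(w in B) W w i j) / fine (P B)).

Definition markov_chain p : Prop :=
  [/\ forall k x, measurable (X k @^-1` [set x]),
      stochastic p
    & forall n (x : nat -> S), P (history n x) != 0%E ->
        cond_prob (X n.+1 @^-1` [set x n.+1]) (history n x) =
          p (x n) (x n.+1)].

(* For a Markov chain with invariant distribution pi, stationarity of the
   process is the same as stationarity of its one-dimensional marginals. *)
Definition stationary pi : Prop :=
  forall k x, P (X k @^-1` [set x]) = (pi x)%:E.

(* m_k = V(X_k) - E[V(X_k) | X_{k-1}], used for k >= 1 only. *)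
Definition mart_diff (d : nat) (V : S -> 'cV[R]_d) (k : nat) (w : T) :
    'cV[R]_d :=
  V (X k w) - cond_mean (V \o X k) (X k.-1 @^-1` [set X k.-1 w]).

(* v(x) = E[m_1 m_1^T | X_0 = x] *)
Definition cond_cov (d : nat) (V : S -> 'cV[R]_d) (x : S) : 'M[R]_d :=
  cond_mean (fun w => mart_diff V 1 w *m (mart_diff V 1 w)^T)
            (X 0 @^-1` [set x]).

Definition asymptotic_cov pi (d : nat) (V : S -> 'cV[R]_d) : 'M[R]_d :=
  state_mean pi (cond_cov V).

Definition normalized_sum pi (d : nat) (r : S -> 'cV[R]_d) (n : nat) (w : T) :
    'cV[R]_d :=
  (Num.sqrt n%:R)^-1 *: \sum_(1 <= k < n.+1) (r (X k.-1 w) - state_mean pi r).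

End Chain.

(* Main.v *)
Require Import Defs.
From HB Require Import structures.
From mathcomp Require Import all_boot all_order all_algebra.
From mathcomp Require Import all_classical all_reals all_analysis.
From mathcomp Require Import measurable_realfun.
From mathcomp Require Import ring lra.

(** The sum of the r (X_k) - rbar is, by the Poisson equation, a martingale up to a
    bounded term, and its increments depend only on two consecutive states of the
    chain. It is compared with a Gaussian vector by Lindeberg's method: one step of
    the chain at a time is traded for one unit of Gaussian variance. The outcome is
    the bound C (1 + ln n) / sqrt n for the Wasserstein distance
    ([wasserstein_log_rate]), from which both claims follow: ln n is at most
    n^s / s for s = (1 - beta) / 2, and 1 + ln n is at most 2 (ln n)^2 for large n.

    After multiplication by the inverse square root of the covariance the increments
    have pi-averaged covariance I. Given a Lipschitz test function h, let f_k be its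
    smoothing by a Gaussian of variance k. The heart of the matter is that around
    every point f_k is close to a quadratic polynomial: for a displacement a, the
    error is at most of order L exp |a| / k ([smooth_quadratic]). This is obtained
    without differentiating f_k: by the Cameron-Martin formula, moving the centre of
    the smoothing only multiplies the Gaussian weight by an explicit exponential,
    which is expanded to second order.

    On the quadratic part, a step of the chain and a standard Gaussian shift differ
    by the pairing of the Hessian with v - I, where v is the conditional covariance
    of the increment. The function v - I of the state has mean 0 under pi, hence is
    of the form 2 (W - P W) ([poisson_equation]); this is where irreducibility
    enters, and periodic chains are covered. Adding to f_k the pairing of W with the
    second differences of f_k makes the quadratic parts agree exactly
    ([lindeberg_step]). The remaining errors are of order L / k, and they sum to
    order L ln n ([chain_op_gaussian]). Since h (B v / sqrt n) has Lipschitz constant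
    of order 1 / sqrt n, this is the announced bound.

    On the Gaussian side three formulas are used: Cameron-Martin, the semigroup
    property, and exponential moments. They are proved on the line from the normal
    density, carried to every dimension by Tonelli's theorem for one particular
    Gaussian vector ([gaussian_calculus_exists]), and transferred to the given one,
    because boxes determine a law on R^d ([std_gaussian_law]). On the chain side, the
    expectation of a function of the sum and of the last state is obtained by
    iterating a transition operator on finite sums ([expectation_chain]). *)

Set Implicit Arguments.
Unset Strict Implicit.
Unset Printing Implicit Defensive.
Import Order.TTheory GRing.Theory Num.Theory.
Import numFieldNormedType.Exports.

Local Open Scope classical_set_scope.
Local Open Scope ring_scope.

(** * Affine changes of variable for Lebesgue measure *)
Section image_measure.
Context d d' (T1 : measurableType d) (T2 : measurableType d') (R : realType).

(** The pushforward packed with its structure of measure, which depends on the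
    measurability proof [mf] and cannot be recovered from [pushforward m f]. *)
Definition image_measure (m : {measure set T1 -> \bar R}) (f : T1 -> T2)
    (mf : measurable_fun setT f) : {measure set T2 -> \bar R} :=
  measure_function_pushforward__canonical__measure_function_Measure m mf.

Lemma ge0_integral_image m f (mf : measurable_fun setT f) (F : T2 -> \bar R) :
  measurable_fun setT F -> (forall y, 0 <= F y)%E ->
  (\int[image_measure m mf]_y F y = \int[m]_x F (f x))%E.
Proof.
by move=> mF F0; rewrite (@ge0_integral_pushforward _ _ _ _ _ f mf m setT F).
Qed.
End image_measure.

Section lebesgue_affine.
Context (R : realType).
Notation mu := (@lebesgue_measure R).

Lemma measurable_affine (s m : R) : measurable_fun setT (fun x : measurableTypeR R => s * x + m : measurableTypeR R).
Proof. by apply: measurable_funD => //; apply: measurable_funM. Qed.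

(** The image of Lebesgue measure under x |-> s x + m, multiplied by s, gives every
    interval ]a, b] its length, hence is Lebesgue measure. *)
Lemma ge0_integral_affine (s m : R) (F : R -> \bar R) : 0 < s ->
  measurable_fun setT F -> (forall x, 0 <= F x)%E ->
  (s%:E * \int[mu]_x F (s * x + m)%R = \int[mu]_x F x)%E.
Proof.
move=> s0 mF F0; have mphi := measurable_affine s m.
pose nu : {measure set (measurableTypeR R) -> \bar R} :=
  mscale (NngNum (ltW s0)) (image_measure mu mphi).
have nuE : forall A, measurable A -> mu A = nu A.
  apply: lebesgue_measure_unique => _ [[a b]] _ <-.
  transitivity (s%:E * mu ((fun x : R => s * x + m)%R @^-1` `]a, b]))%E; last by [].
  have -> : (fun x : R => s * x + m) @^-1` `]a, b] = `](a - m) / s, (b - m) / s]%classic.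
    by apply/seteqP; split => x /=; rewrite !in_itv/= ltr_pdivrMr// ler_pdivlMr// ltrBlDr lerBrDr (mulrC x).
  rewrite !lebesgue_measure_itv/= !lte_fin ltr_pM2r ?invr_gt0// ltrD2r.
  case: ifPn => [ab|_]; last by rewrite mule0.
  rewrite -!EFinD -EFinM; congr (_%:E); field.
  by rewrite gt_eqF.
rewrite [RHS](eq_measure_integral nu); last by move=> A mA _; exact: nuE.
by rewrite /nu ge0_integral_mscale//= ge0_integral_image.
Qed.
End lebesgue_affine.

(** * The normal law on the line *)
Section normal.
Context (R : realType).
Notation mu := (@lebesgue_measure R).
Notation gamma := (normal_prob (0:R) 1).

(** The density and the Radon-Nikodym derivative have the same integral on every
    measurable set, so they agree almost everywhere. *)
Lemma ge0_integral_normal_prob (m s : R) (F : R -> \bar R) :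
  measurable_fun setT F -> (forall x, 0 <= F x)%E ->
  (\int[normal_prob m s]_x F x = \int[mu]_x (F x * (normal_pdf m s x)%:E))%E.
Proof.
move=> mF F0; have dom := normal_prob_dominates m s.
rewrite -(Radon_Nikodym_SigmaFinite.change_of_variables dom)//.
apply: ae_eq_integral => //.
- apply: emeasurable_funM => //; apply: (measurable_int mu).
  exact: Radon_Nikodym_SigmaFinite.f_integrable.
- apply: emeasurable_funM => //; apply/measurable_EFinP; exact: measurable_normal_pdf.
- apply: ae_eqe_mul2l.
  apply: integral_ae_eq => //.
  + exact: Radon_Nikodym_SigmaFinite.f_integrable.
  + apply/measurable_EFinP; exact: measurable_normal_pdf.
  + by move=> E _ mE; rewrite -Radon_Nikodym_SigmaFinite.f_integral.
Qed.

Lemma normal_pdf_affine (s m x : R) : 0 < s ->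
  s * normal_pdf m s (s * x + m) = normal_pdf 0 1 x.
Proof.
move=> s0; rewrite !normal_pdfE ?gt_eqF// /normal_peak /normal_fun.
rewrite mulrA; congr (_ * _); last first.
  congr expR; field; by rewrite gt_eqF.
rewrite -mulrnAr sqrtrM ?sqr_ge0// sqrtr_sqr gtr0_norm// invfM mulrA divff ?gt_eqF//.
by rewrite mul1r expr1n mul1r.
Qed.

Lemma ge0_integral_normal_affine (s m : R) (F : R -> \bar R) : 0 < s ->
  measurable_fun setT F -> (forall x, 0 <= F x)%E ->
  (\int[gamma]_x F (s * x + m)%R = \int[normal_prob m s]_x F x)%E.
Proof.
move=> s0 mF F0.
have mG : measurable_fun setT (fun x : R => F (s * x + m)).
  by apply: (measurableT_comp mF); exact: measurable_affine.
apply: (etrans (ge0_integral_normal_prob 0 1 mG (fun x => F0 _))).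
apply: (etrans _ (esym (ge0_integral_normal_prob m s mF F0))).
have mp : measurable_fun setT (fun x => F x * (normal_pdf m s x)%:E)%E.
  by apply: emeasurable_funM => //; apply/measurable_EFinP; exact: measurable_normal_pdf.
have p0 x : (0 <= F x * (normal_pdf m s x)%:E)%E.
  by rewrite mule_ge0// lee_fin normal_pdf_ge0.
apply: (etrans _ (ge0_integral_affine m s0 mp p0)).
rewrite -ge0_integralZl//.
- apply: eq_integral => x _; rewrite muleCA -EFinM normal_pdf_affine//.
- exact: (measurableT_comp mp (measurable_affine s m)).
- by rewrite lee_fin ltW.
Qed.

(** The exponential is the ratio of the densities of N(a, 1) and N(0, 1). *)
Lemma normal_cameron_martin (a : R) (F : R -> \bar R) :
  measurable_fun setT F -> (forall x, 0 <= F x)%E ->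
  (\int[gamma]_x F (x + a)%R =
   \int[gamma]_x (F x * (expR (a * x - a ^+ 2 / 2))%:E))%E.
Proof.
move=> mF F0.
transitivity (\int[gamma]_x F (1 * x + a)%R)%E.
  by apply: eq_integral => x _; rewrite mul1r.
have mG : measurable_fun setT (fun x : R => F x * (expR (a * x - a ^+ 2 / 2))%:E)%E.
  apply: emeasurable_funM => //; apply/measurable_EFinP.
  by apply: measurableT_comp => //; apply: measurable_funB => //; exact: measurable_funM.
have G0 x : (0 <= F x * (expR (a * x - a ^+ 2 / 2))%:E)%E.
  by rewrite mule_ge0// lee_fin expR_ge0.
apply: (etrans (ge0_integral_normal_affine a ltr01 mF F0)).
apply: (etrans (ge0_integral_normal_prob a 1 mF F0)).
apply: (etrans _ (esym (ge0_integral_normal_prob 0 1 mG G0))).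
apply: eq_integral => x _; rewrite -muleA -EFinM; congr (_ * _%:E)%E.
rewrite !normal_pdfE ?oner_eq0// mulrCA; congr (_ * _).
by rewrite /normal_fun -expRD; congr expR; field.
Qed.

(** Completing the square. For x standard normal and y = t x plus an independent
    standard normal, the joint density is rewritten as the conditional density of
    x given y times the density of y. *)
Lemma normal_pdf_mul (t x y : R) : 0 < t ->
  normal_pdf 0 1 x * normal_pdf (t * x) 1 y =
  normal_pdf (t * y / (1 + t ^+ 2)) (Num.sqrt (1 + t ^+ 2))^-1 x *
  normal_pdf 0 (Num.sqrt (1 + t ^+ 2)) y.
Proof.
move=> t0; have c0 : 0 < 1 + t ^+ 2 by rewrite ltr_wpDr// sqr_ge0.
have s0 : 0 < Num.sqrt (1 + t ^+ 2) by rewrite sqrtr_gt0.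
rewrite !normal_pdfE ?gt_eqF ?invr_gt0//.
rewrite mulrACA [RHS]mulrACA; congr (_ * _).
  rewrite /normal_peak !(exprVn, sqr_sqrtr) ?ltW// -!invfM; congr (_^-1).
  rewrite -!mulrnAr !sqrtrM ?expr1n ?ler01 ?invr_ge0 ?ltW// sqrtrV ?ltW// mulrACA.
  by rewrite sqrtr1 !mul1r [RHS]mulrACA mulVf ?gt_eqF// mul1r.
rewrite /normal_fun -!expRD; congr expR.
rewrite exprVn sqr_sqrtr ?ltW//.
by field; rewrite gt_eqF.
Qed.

(** After Tonelli the inner integral is that of a conditional density, that is 1. *)
Lemma normal_semigroup (t : R) (F : R -> \bar R) : 0 < t ->
  measurable_fun setT F -> (forall x, 0 <= F x)%E ->
  (\int[gamma]_x \int[gamma]_y F (t * x + y)%R =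
   \int[gamma]_x F (Num.sqrt (1 + t ^+ 2) * x)%R)%E.
Proof.
move=> t0 mF F0.
have c0 : 0 < 1 + t ^+ 2 by rewrite ltr_wpDr// sqr_ge0.
have s0 : 0 < Num.sqrt (1 + t ^+ 2) by rewrite sqrtr_gt0.
transitivity (\int[gamma]_x \int[mu]_y (F y * (normal_pdf (t * x)%R 1 y)%:E))%E.
  apply: eq_integral => x _.
  apply: (etrans _ (ge0_integral_normal_prob (t * x) 1 mF F0)).
  apply: (etrans _ (ge0_integral_normal_affine (t * x) ltr01 mF F0)).
  by apply: eq_integral => y _; rewrite mul1r addrC.
have mpdf : measurable_fun setT (fun z : R * R => normal_pdf (t * z.1) 1 z.2).
  under eq_fun do rewrite normal_pdfE ?oner_eq0//.
  apply: measurable_funM => //; apply: measurableT_comp => //.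
  apply: measurable_funM => //; apply: measurableT_comp => //.
  apply: measurable_funX; apply: measurable_funB => //.
  exact: measurable_funM.
have mG : measurable_fun setT (fun z : R * R => (F z.2 * (normal_pdf (t * z.1) 1 z.2)%:E)%E).
  apply: emeasurable_funM; last exact/measurable_EFinP.
  exact: measurableT_comp.
have H0 x : (0 <= \int[mu]_y (F y * (normal_pdf (t * x)%R 1 y)%:E))%E.
  by apply: integral_ge0 => y _; rewrite mule_ge0// lee_fin normal_pdf_ge0.
have mH0 : measurable_fun setT (fun x : R => \int[mu]_y (F y * (normal_pdf (t * x)%R 1 y)%:E))%E.
  have G0 z : (0 <= F z.2 * (normal_pdf (t * z.1) 1 z.2)%:E)%E.
    by rewrite mule_ge0// lee_fin normal_pdf_ge0.
  exact: (measurable_fun_fubini_tonelli_F (m2 := mu) _ mG G0).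
apply: (etrans (ge0_integral_normal_prob 0 1 mH0 H0)).
transitivity (\int[mu]_x \int[mu]_y (F y * (normal_pdf 0 1 x * normal_pdf (t * x) 1 y)%:E))%E.
  apply: eq_integral => x _; rewrite -ge0_integralZr//.
  - by apply: eq_integral => y _; rewrite -muleA -EFinM (mulrC (normal_pdf 0 1 x)).
  - exact: (measurableT_comp mG (pair1_measurable x)).
  - by move=> y _; rewrite mule_ge0// lee_fin normal_pdf_ge0.
  - by rewrite lee_fin normal_pdf_ge0.
have mH : measurable_fun setT (fun z : R * R => (F z.2 * (normal_pdf 0 1 z.1 * normal_pdf (t * z.1) 1 z.2)%:E)%E).
  apply: emeasurable_funM; first exact: measurableT_comp.
  apply/measurable_EFinP/measurable_funM => //.
  exact: (measurableT_comp (measurable_normal_pdf _ _)).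
have pH z : (0 <= F z.2 * (normal_pdf 0 1 z.1 * normal_pdf (t * z.1) 1 z.2)%:E)%E.
  by rewrite mule_ge0// lee_fin mulr_ge0// normal_pdf_ge0.
apply: (etrans (fubini_tonelli (m1 := mu) (m2 := mu) _ mH pH)).
transitivity (\int[normal_prob (0:R) (Num.sqrt (1 + t ^+ 2))]_y F y)%E; last first.
  apply: (etrans (esym (ge0_integral_normal_affine 0 s0 mF F0))).
  by apply: eq_integral => y _; rewrite addr0.
apply: (etrans _ (esym (ge0_integral_normal_prob 0 _ mF F0))).
apply: eq_integral => y _ /=.
under eq_integral do rewrite normal_pdf_mul// EFinM muleCA.
rewrite ge0_integralZr//.
- by rewrite integral_normal_pdf mul1e.
- by apply/measurable_EFinP; exact: measurable_normal_pdf.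
- by move=> x _; rewrite lee_fin normal_pdf_ge0.
- by rewrite mule_ge0// lee_fin normal_pdf_ge0.
Qed.

(** The Cameron-Martin formula for the constant function 1. *)
Lemma integral_normal_expR (a : R) :
  (\int[gamma]_x (expR (a * x))%:E = (expR (a ^+ 2 / 2))%:E)%E.
Proof.
have mE : measurable_fun setT (fun x : R => (expR (a * x))%:E).
  by apply/measurable_EFinP; apply: measurableT_comp => //; exact: measurable_funM.
have := @normal_cameron_martin a (cst 1%E) (measurable_cst _) (fun=> lee01).
rewrite integral_cst//= probability_setT mule1.
under eq_integral do rewrite mul1e expRB EFinM.
rewrite ge0_integralZr//.
move=> e; rewrite -[RHS]mul1e [X in (_ = X * _)%E]e -muleA -EFinM mulVf ?mule1//.
by rewrite gt_eqF// expR_gt0.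
Qed.

Lemma integral_normal_expR_norm (c : R) : 0 <= c ->
  (\int[gamma]_x (expR (c * `|x|))%:E < +oo)%E.
Proof.
move=> c0.
have mE a : measurable_fun setT (fun x : R => (expR (a * x))%:E).
  by apply/measurable_EFinP; apply: measurableT_comp => //; exact: measurable_funM.
apply: (@le_lt_trans _ _ (\int[gamma]_x ((expR (c * x))%:E + (expR (- c * x))%:E))%E).
  apply: ge0_le_integral => //.
  - apply/measurable_EFinP; apply: measurableT_comp => //; apply: measurable_funM => //.
  - exact: (emeasurable_funD (mE c) (mE (- c))).
  - move=> x _; rewrite -EFinD lee_fin; have [x0|x0] := lerP 0 (x : R).
      by rewrite ger0_norm// lerDl expR_ge0.
    by rewrite ltr0_norm// mulrN mulNr lerDr expR_ge0.
rewrite ge0_integralD//; [|exact: mE|exact: mE].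
by rewrite !integral_normal_expR -EFinD ltry.
Qed.
End normal.

(** * Column vectors and Borel functions *)
Section vectors.
Context (R : realType).

Definition consv d (x : R) (v : 'cV[R]_d) : 'cV[R]_d.+1 :=
  \col_i oapp (fun j => v j 0) x (unlift ord0 i).

Lemma consv0 d x (v : 'cV[R]_d) : consv x v ord0 0 = x.
Proof. by rewrite mxE unlift_none. Qed.

Lemma consvS d x (v : 'cV[R]_d) j : consv x v (lift ord0 j) 0 = v j 0.
Proof. by rewrite mxE liftK. Qed.

Lemma consv_eta d (a : 'cV[R]_d.+1) :
  a = consv (a ord0 0) (\col_j a (lift ord0 j) 0).
Proof.
apply/colP => i; case: (unliftP ord0 i) => [j ->|->]; last by rewrite consv0.
by rewrite consvS mxE.
Qed.

Lemma consvD d x y (u v : 'cV[R]_d) :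
  consv x u + consv y v = consv (x + y) (u + v).
Proof.
apply/colP => i; case: (unliftP ord0 i) => [j ->|->].
  by rewrite mxE !consvS mxE.
by rewrite mxE !consv0.
Qed.

Lemma consvZ d t x (u : 'cV[R]_d) : t *: consv x u = consv (t * x) (t *: u).
Proof.
apply/colP => i; case: (unliftP ord0 i) => [j ->|->].
  by rewrite mxE !consvS mxE.
by rewrite mxE !consv0.
Qed.

Lemma forall_consv d x (u : 'cV[R]_d) (A : 'I_d.+1 -> set R) :
  (forall i, A i (consv x u i 0)) <->
  A ord0 x /\ forall j, A (lift ord0 j) (u j 0).
Proof.
split=> [h|[h0 h] i].
  by split=> [|j]; [have := h ord0|have := h (lift ord0 j)]; rewrite ?consv0 ?consvS.
by case: (unliftP ord0 i) => [j ->|->]; rewrite ?consv0 ?consvS.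
Qed.

Definition coord_measurable d disp (T : measurableType disp) (u : T -> 'cV[R]_d) :=
  forall i, measurable_fun setT (fun w => u w i 0).

(** Measurability tested on random vectors, so that no sigma-algebra has to be
    chosen on ['cV[R]_d]. *)
Definition borel_fun d dV (V : measurableType dV) (F : 'cV[R]_d -> V) : Prop :=
  forall disp (T : measurableType disp) (u : T -> 'cV[R]_d),
    coord_measurable u -> measurable_fun setT (F \o u).

Lemma coord_measurable_consv d disp (T : measurableType disp) (x : T -> R) (u : T -> 'cV[R]_d) :
  measurable_fun setT x -> coord_measurable u ->
  coord_measurable (fun w => consv (x w) (u w)).
Proof.
move=> mx mu i; case: (unliftP ord0 i) => [j ->|->].
  by under eq_fun do rewrite consvS; exact: mu.
by under eq_fun do rewrite consv0; exact: mx.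
Qed.

Lemma coord_measurableD d disp (T : measurableType disp) (u v : T -> 'cV[R]_d) :
  coord_measurable u -> coord_measurable v ->
  coord_measurable (fun w => u w + v w).
Proof.
move=> mu mv i; under eq_fun do rewrite mxE; exact: measurable_funD.
Qed.

Lemma coord_measurableZ d disp (T : measurableType disp) t (u : T -> 'cV[R]_d) :
  coord_measurable u -> coord_measurable (fun w => t *: u w).
Proof.
move=> mu i; under eq_fun do rewrite mxE; exact: measurable_funM.
Qed.

Lemma coord_measurable_comp d disp (T : measurableType disp) disp' (T' : measurableType disp')
    (u : T -> 'cV[R]_d) (f : T' -> T) :
  coord_measurable u -> measurable_fun setT f -> coord_measurable (u \o f).
Proof. by move=> mu mf i; exact: (measurableT_comp (mu i) mf). Qed.

End vectors.

(** * Uniqueness of the standard Gaussian law *)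
Section law_unique.
Context (R : realType) (d : nat).

Definition tuple_of_cV (v : 'cV[R]_d) : d.-tuple R := [tuple v i 0 | i < d].
Definition cV_of_tuple (t : d.-tuple R) : 'cV[R]_d := \col_i tnth t i.

Lemma tuple_of_cVK : cancel tuple_of_cV cV_of_tuple.
Proof. by move=> v; apply/colP => i; rewrite mxE tnth_mktuple. Qed.

Definition box (A : 'I_d -> set R) : set (d.-tuple R) :=
  [set t | forall i, A i (tnth t i)].

Lemma measurable_tuple_of_cV disp (T : measurableType disp) (u : T -> 'cV[R]_d) :
  coord_measurable u -> measurable_fun setT (tuple_of_cV \o u).
Proof.
move=> mu; apply/measurable_fun_tnthP => i.
rewrite (_ : _ \o _ = fun w => u w i 0); first exact: mu.
by apply/funext => w /=; rewrite tnth_mktuple.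
Qed.

Lemma coord_measurable_cV_of_tuple : coord_measurable cV_of_tuple.
Proof. by move=> i; under eq_fun do rewrite mxE; exact: measurable_tnth. Qed.

Let boxes : set (set (d.-tuple R)) :=
  [set B | exists2 A : 'I_d -> set R, (forall i, measurable (A i)) & B = box A].

Let measurable_box A : (forall i, measurable (A i)) -> measurable (box A).
Proof.
move=> mA; have -> : box A = \bigcap_(i in setT) ((@tnth d R ^~ i) @^-1` A i).
  by apply/seteqP; split => t /= h i; [move=> _; exact: h|exact: (h i I)].
apply: fin_bigcap_measurable => [|i _]; first exact: finite_finset.
by rewrite -[X in measurable X]setTI; apply: measurable_tnth.
Qed.

Let measurable_boxes : @measurable _ (d.-tuple R) `<=` <<s boxes >>.
Proof.
apply: smallest_sub; first exact: smallest_sigma_algebra.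
move=> B; rewrite -bigcup_seq => -[i _ [A mA <-]].
apply: sub_sigma_algebra; exists (fun j => if j == i then A else setT).
  by move=> j; case: ifP.
rewrite setTI; apply/seteqP; split => t /=.
  by move=> At j; case: eqVneq => [->|].
by move=> /(_ i); rewrite eqxx.
Qed.

(** The boxes form a pi-system generating the sigma-algebra of [d.-tuple R], and
    being standard Gaussian prescribes the measure of each of them. *)
Lemma std_gaussian_law disp1 (T1 : measurableType disp1) (P1 : probability T1 R)
    (Z1 : T1 -> 'cV[R]_d) disp2 (T2 : measurableType disp2) (P2 : probability T2 R)
    (Z2 : T2 -> 'cV[R]_d) (F : 'cV[R]_d -> \bar R) :
  std_gaussian P1 Z1 -> std_gaussian P2 Z2 -> borel_fun F -> (forall v, 0 <= F v)%E ->
  (\int[P1]_w F (Z1 w) = \int[P2]_w F (Z2 w))%E.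
Proof.
move=> [m1 g1] [m2 g2] bF F0.
have mF : measurable_fun setT (F \o cV_of_tuple) := bF _ _ _ coord_measurable_cV_of_tuple.
pose n1 := image_measure P1 (measurable_tuple_of_cV m1).
pose n2 := image_measure P2 (measurable_tuple_of_cV m2).
have E1 : (\int[n1]_t F (cV_of_tuple t) = \int[P1]_w F (Z1 w))%E.
  rewrite ge0_integral_image//; apply: eq_integral => w _.
  by rewrite /= tuple_of_cVK.
have E2 : (\int[n2]_t F (cV_of_tuple t) = \int[P2]_w F (Z2 w))%E.
  rewrite ge0_integral_image//; apply: eq_integral => w _.
  by rewrite /= tuple_of_cVK.
rewrite -E1 -E2; apply: eq_measure_integral => B mB _.
have boxE A : (forall i, measurable (A i)) -> n1 (box A) = n2 (box A).
  move=> mA.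
  have pre (T : Type) (Z : T -> 'cV[R]_d) :
      (tuple_of_cV \o Z) @^-1` box A = [set w | forall i, A i (Z w i 0)].
    by apply/seteqP; split => w /= h i; have := h i; rewrite tnth_mktuple.
  transitivity (P1 ((tuple_of_cV \o Z1) @^-1` box A)); first by [].
  transitivity (P2 ((tuple_of_cV \o Z2) @^-1` box A)); last by [].
  by rewrite !pre g1// g2.
apply: (g_sigma_algebra_measure_unique boxes _ (fun=> setT)) => //.
- by move=> _ [A mA ->]; exact: measurable_box.
- by move=> _; exists (fun=> setT) => //; apply/seteqP; split.
- by rewrite bigcup_const.
- move=> _ _ [A mA ->] [A' mA' ->]; exists (fun i => A i `&` A' i).
    by move=> i; exact: measurableI.
  apply/seteqP; split => t /=.
    by move=> [h h'] i; split; [exact: h|exact: h'].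
  by move=> h; split => i; have [] := h i.
- by move=> _ [A mA ->]; exact: boxE.
- by move=> _; rewrite (_ : n1 _ = 1%E) ?ltry//; exact: probability_setT.
- exact: measurable_boxes.
Qed.

End law_unique.

(** * Gaussian integration formulas in every dimension *)
Section model.
Context (R : realType).
Notation gamma := (normal_prob (0:R) 1).

(** The Cameron-Martin formula, the stability of the law under t Z + Z' and the
    exponential moments. All are stated for nonnegative integrands, so that
    Tonelli's theorem carries them from dimension d to dimension d + 1. *)
Definition gaussian_calculus d disp (T : measurableType disp) (P : probability T R)
    (Z : T -> 'cV[R]_d) : Prop :=
  [/\ std_gaussian P Z,
      forall F : 'cV[R]_d -> \bar R, borel_fun F -> (forall v, 0 <= F v)%E ->
        forall a : 'cV[R]_d,
        (\int[P]_w F (Z w + a)%R =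
         \int[P]_w (F (Z w) * (expR (\sum_i a i 0 * Z w i 0 - (\sum_i a i 0 ^+ 2) / 2))%:E))%E,
      forall F : 'cV[R]_d -> \bar R, borel_fun F -> (forall v, 0 <= F v)%E ->
        forall t : R, 0 < t ->
        (\int[P]_w \int[P]_w' F (t *: Z w + Z w')%R =
         \int[P]_w F (Num.sqrt (1 + t ^+ 2) *: Z w)%R)%E
    & forall c : R, 0 <= c -> (\int[P]_w (expR (c * \sum_i `|Z w i 0|))%:E < +oo)%E].

Lemma gaussian_calculus0 :
  gaussian_calculus gamma (fun _ : R => 0 : 'cV[R]_0).
Proof.
split.
- split=> [[]//|A mA]; rewrite big_ord0 (_ : [set w | _] = setT) ?probability_setT//.
  by apply/seteqP; split => // w _ [].
- move=> F bF F0 a; apply: eq_integral => x _.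
  by rewrite !big_ord0 mul0r subr0 expR0 mule1; congr F; apply/matrixP => -[].
- move=> F bF F0 t t0; rewrite (_ : (fun _ => _) = cst (F 0)).
    rewrite integral_cst//= probability_setT mule1 (_ : (fun _ => _) = cst (F 0)).
      by rewrite integral_cst//= probability_setT mule1.
    by apply/funext => x; congr F; apply/matrixP => -[].
  apply/funext => x; rewrite (_ : (fun _ => _) = cst (F 0)).
    by rewrite integral_cst//= probability_setT mule1.
  by apply/funext => y; congr F; apply/matrixP => -[].
- move=> c c0; under eq_integral do rewrite big_ord0 mulr0 expR0.
  by rewrite integral_cst//= probability_setT mule1 ltry.
Qed.

Section step.
Context d disp (T : measurableType disp) (P : probability T R) (Z : T -> 'cV[R]_d).
Hypothesis gcZ : gaussian_calculus P Z.

Let Z' (w : R * T) : 'cV[R]_d.+1 := consv w.1 (Z w.2).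

Let mZ : coord_measurable Z. Proof. by have [[]] := gcZ. Qed.

Let mZ' : coord_measurable Z'.
Proof.
apply: coord_measurable_consv => //.
exact: (coord_measurable_comp mZ).
Qed.

Let std_gaussianS : std_gaussian (gamma \x P)%E Z'.
Proof.
have [[_ gZ] _ _ _] := gcZ.
split; first exact: mZ'.
move=> A mA; rewrite big_ord_recl.
have -> : [set w | forall i, A i (Z' w i 0)] =
    A ord0 `*` [set w | forall j, A (lift ord0 j) (Z w j 0)].
  by apply/seteqP; split => -[x w] /=; rewrite forall_consv.
apply: (etrans (product_measure1E (normal_prob (0 : R) 1) P (mA ord0) _)).
  have -> : [set w | forall j, A (lift ord0 j) (Z w j 0)] =
      \bigcap_(j in setT) ((fun w => Z w j 0) @^-1` A (lift ord0 j)).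
    by apply/seteqP; split => t /= h i; [move=> _; exact: h|exact: (h i I)].
  apply: fin_bigcap_measurable => [|i _]; first exact: finite_finset.
  by rewrite -[X in measurable X]setTI; apply: mZ.
by congr (_ * _)%E; exact: (gZ (fun j => A (lift ord0 j)) (fun j => mA _)).
Qed.

(** The weight factors into the weight of the first coordinate and that of the
    others, so the shift can be made one block after the other. *)
Let cameron_martinS (F : 'cV[R]_d.+1 -> \bar R) (bF : borel_fun F)
    (F0 : forall v, (0 <= F v)%E) (a : 'cV[R]_d.+1) :
  (\int[gamma \x P]_w F (Z' w + a)%R =
   \int[gamma \x P]_w (F (Z' w) * (expR (\sum_i a i 0 * Z' w i 0 - (\sum_i a i 0 ^+ 2) / 2))%:E))%E.
Proof.
have [_ cm _ _] := gcZ.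
pose a0 := a ord0 0; pose a' : 'cV[R]_d := \col_j a (lift ord0 j) 0.
have aE : a = consv a0 a' by rewrite {1}(consv_eta a).
have bF1 x : borel_fun (fun v => F (consv x v)).
  move=> disp' T' u mu; apply: (bF _ _ (fun w => consv x (u w))).
  exact: coord_measurable_consv.
have mG : measurable_fun setT (fun w : R * T => F (Z' w + a)).
  by apply: (bF _ _ (fun w => Z' w + a)); apply: coord_measurableD => // i; exact: measurable_cst.
pose e1 (x : R) := expR (a0 * x - a0 ^+ 2 / 2).
pose e2 (w : T) := expR (\sum_i a' i 0 * Z w i 0 - (\sum_i a' i 0 ^+ 2) / 2).
have me2 : measurable_fun setT e2.
  apply: measurableT_comp => //; apply: measurable_funB => //.
  by apply: measurable_sum => i; apply: measurable_funM => //; exact: mZ.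
have me1 : measurable_fun setT e1.
  by apply: measurableT_comp => //; apply: measurable_funB => //; exact: measurable_funM.
have eE w : expR (\sum_i a i 0 * Z' w i 0 - (\sum_i a i 0 ^+ 2) / 2) = e1 w.1 * e2 w.2.
  rewrite /e1 /e2 -expRD !big_ord_recl aE !consv0; congr expR.
  under eq_bigr do rewrite !consvS.
  under [in X in _ - (_ + X) / 2]eq_bigr do rewrite !consvS.
  by ring.
have mH1 : measurable_fun setT (fun w : R * T => F (consv (w.1 + a0) (Z w.2)) * (e2 w.2)%:E)%E.
  apply: emeasurable_funM.
    apply: (bF _ _ (fun w : R * T => consv (w.1 + a0) (Z w.2))).
    apply: coord_measurable_consv; first exact: measurable_funD.
    exact: (coord_measurable_comp mZ).
  by apply/measurable_EFinP; exact: measurableT_comp.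
have mH2 : measurable_fun setT (fun w : R * T => F (consv w.1 (Z w.2)) * (e1 w.1 * e2 w.2)%:E)%E.
  apply: emeasurable_funM; first exact: (bF _ _ Z').
  by apply/measurable_EFinP/measurable_funM; exact: measurableT_comp.
have p1 w : (0 <= F (consv (w.1 + a0) (Z w.2)) * (e2 w.2)%:E)%E.
  by rewrite mule_ge0// lee_fin expR_ge0.
have p2 w : (0 <= F (consv w.1 (Z w.2)) * (e1 w.1 * e2 w.2)%:E)%E.
  by rewrite mule_ge0// lee_fin mulr_ge0// expR_ge0.
apply: (etrans (fubini_tonelli1 (m1 := gamma) (m2 := P) _ mG (fun=> F0 _))).
transitivity (\int[gamma]_x \int[P]_w (F (consv (x + a0)%R (Z w)) * (e2 w)%:E))%E.
  apply: eq_integral => x _; rewrite /fubini_F/=.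
  apply: (etrans _ (cm _ (bF1 (x + a0)) (fun=> F0 _) a')).
  by apply: eq_integral => w _; rewrite /Z' aE consvD.
apply: (etrans (fubini_tonelli (m1 := gamma) (m2 := P) _ mH1 p1)) => /=.
transitivity (\int[gamma \x P]_w (F (consv w.1 (Z w.2)) * (e1 w.1 * e2 w.2)%:E))%E; last first.
  by apply: eq_integral => w _; rewrite eE.
apply: (etrans _ (esym (fubini_tonelli2 (m1 := gamma) (m2 := P) _ mH2 p2))) => /=.
apply: eq_integral => w _; rewrite /fubini_G/=.
have mf : measurable_fun setT (fun x : R => F (consv x (Z w)) * (e2 w)%:E)%E.
  apply: emeasurable_funM => //; apply: (bF _ _ (fun x : R => consv x (Z w))).
  by apply: coord_measurable_consv => // i; exact: measurable_cst.
have pf x : (0 <= F (consv x (Z w)) * (e2 w)%:E)%E.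
  by rewrite mule_ge0// lee_fin expR_ge0.
apply: (etrans (normal_cameron_martin a0 mf pf)).
by apply: eq_integral => x _; rewrite -muleA -EFinM mulrC.
Qed.

Let semigroupS (F : 'cV[R]_d.+1 -> \bar R) (bF : borel_fun F)
    (F0 : forall v, (0 <= F v)%E) (t : R) (t0 : 0 < t) :
  (\int[gamma \x P]_w \int[gamma \x P]_w' F (t *: Z' w + Z' w')%R =
   \int[gamma \x P]_w F (Num.sqrt (1 + t ^+ 2) *: Z' w)%R)%E.
Proof.
have [_ _ sg _] := gcZ.
have bF1 x : borel_fun (fun v => F (consv x v)).
  move=> disp' T' u mu; apply: (bF _ _ (fun w => consv x (u w))).
  exact: coord_measurable_consv.
pose s := Num.sqrt (1 + t ^+ 2).
have mG : measurable_fun setT (fun w : (R * T) * (R * T) => F (t *: Z' w.1 + Z' w.2)).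
  apply: (bF _ _ (fun w : (R * T) * (R * T) => t *: Z' w.1 + Z' w.2)).
  by apply: coord_measurableD; [apply: coord_measurableZ|]; exact: (coord_measurable_comp mZ').
have mI : measurable_fun setT (fun w : R * T => \int[gamma \x P]_w' F (t *: Z' w + Z' w')%R)%E.
  have pG (w : (R * T) * (R * T)) : (0 <= F (t *: Z' w.1 + Z' w.2)%R)%E by [].
  pose gP : probability (measurableTypeR R * T)%type R := (gamma \x P)%E.
  exact: (measurable_fun_fubini_tonelli_F (m2 := gP) _ mG pG).
have pI w : (0 <= \int[gamma \x P]_w' F (t *: Z' w + Z' w')%R)%E.
  by apply: integral_ge0.
apply: (etrans (fubini_tonelli1 (m1 := gamma) (m2 := P) _ mI pI)).
(* Tonelli brings the two vector integrals together, then the two scalar ones. *)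
transitivity (\int[gamma]_x \int[gamma]_x' \int[P]_w F (consv (t * x + x')%R (s *: Z w)%R))%E.
  apply: eq_integral => x _; rewrite /fubini_F/=.
  have mW w : measurable_fun setT (fun w' : R * T => F (t *: Z' (x, w) + Z' w')).
    apply: (bF _ _ (fun w' : R * T => t *: Z' (x, w) + Z' w')).
    by apply: coord_measurableD => // i; exact: measurable_cst.
  transitivity (\int[P]_w \int[gamma]_x' \int[P]_w' F (consv (t * x + x')%R (t *: Z w + Z w')%R))%E.
    apply: eq_integral => w _.
    apply: (etrans (fubini_tonelli1 (m1 := gamma) (m2 := P) _ (mW w) (fun=> F0 _))).
    apply: eq_integral => x' _; apply: eq_integral => w' _.
    by rewrite /Z' /= consvZ consvD.
  have mK : measurable_fun setT (fun w : (T * R) * T => F (consv (t * x + w.1.2) (t *: Z w.1.1 + Z w.2))).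
    apply: (bF _ _ (fun w : (T * R) * T => consv (t * x + w.1.2) (t *: Z w.1.1 + Z w.2))).
    apply: coord_measurable_consv.
      by apply: measurable_funD => //; exact: measurableT_comp.
    apply: coord_measurableD; [apply: coord_measurableZ|]; apply: (coord_measurable_comp mZ) => //.
    exact: measurableT_comp.
  have mL : measurable_fun setT (fun w : T * R => \int[P]_w' F (consv (t * x + w.2)%R (t *: Z w.1 + Z w')%R))%E.
    exact: (measurable_fun_fubini_tonelli_F (m2 := P) _ mK (fun=> F0 _)).
  have pL (w : T * R) : (0 <= \int[P]_w' F (consv (t * x + w.2)%R (t *: Z w.1 + Z w')%R))%E.
    by apply: integral_ge0.
  apply: (etrans (fubini_tonelli (m1 := P) (m2 := gamma) _ mL pL)) => /=.
  apply: eq_integral => x' _.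
  exact: (sg _ (bF1 _) (fun=> F0 _) t t0).
have mZs (x : R) : coord_measurable (fun w : R * T => consv (t * x + w.1) (s *: Z w.2)).
  apply: coord_measurable_consv; first exact: measurable_funD.
  by apply: coord_measurableZ; exact: (coord_measurable_comp mZ).
have mK : measurable_fun setT (fun w : (R * R) * T => F (consv (t * w.1.1 + w.1.2) (s *: Z w.2))).
  apply: (bF _ _ (fun w : (R * R) * T => consv (t * w.1.1 + w.1.2) (s *: Z w.2))).
  apply: coord_measurable_consv.
    by apply: measurable_funD; [apply: measurable_funM => //|]; exact: measurableT_comp.
  by apply: coord_measurableZ; exact: (coord_measurable_comp mZ).
transitivity (\int[gamma]_x \int[P]_w \int[gamma]_x' F (consv (t * x + x')%R (s *: Z w)%R))%E.
  apply: eq_integral => x _.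
  exact: (fubini_tonelli (m1 := gamma) (m2 := P) _ (bF _ _ _ (mZs x)) (fun=> F0 _)).
have mK' : measurable_fun setT (fun w : (R * T) * R => F (consv (t * w.1.1 + w.2) (s *: Z w.1.2))).
  apply: (bF _ _ (fun w : (R * T) * R => consv (t * w.1.1 + w.2) (s *: Z w.1.2))).
  apply: coord_measurable_consv.
    by apply: measurable_funD => //; apply: measurable_funM => //; exact: measurableT_comp.
  by apply: coord_measurableZ; apply: (coord_measurable_comp mZ); exact: measurableT_comp.
have mL : measurable_fun setT (fun w : R * T => \int[gamma]_x' F (consv (t * w.1 + x')%R (s *: Z w.2)%R))%E.
  exact: (measurable_fun_fubini_tonelli_F (m2 := gamma) _ mK' (fun=> F0 _)).
have pL (w : R * T) : (0 <= \int[gamma]_x' F (consv (t * w.1 + x')%R (s *: Z w.2)%R))%E.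
  by apply: integral_ge0.
apply: (etrans (fubini_tonelli (m1 := gamma) (m2 := P) _ mL pL)) => /=.
have mE : measurable_fun setT (fun w : R * T => F (s *: Z' w)).
  by apply: (bF _ _ (fun w => s *: Z' w)); exact: coord_measurableZ.
apply: (etrans _ (esym (fubini_tonelli2 (m1 := gamma) (m2 := P) _ mE (fun=> F0 _)))) => /=.
apply: eq_integral => w _; rewrite /fubini_G/=.
have mf : measurable_fun setT (fun x : R => F (consv x (s *: Z w))).
  apply: (bF _ _ (fun x : R => consv x (s *: Z w))).
  by apply: coord_measurable_consv => // i; exact: measurable_cst.
apply: (etrans (normal_semigroup t0 mf (fun=> F0 _))).
by apply: eq_integral => x _; rewrite /Z' consvZ.
Qed.

Let exp_momentS (c : R) (c0 : 0 <= c) :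
  (\int[gamma \x P]_w (expR (c * \sum_i `|Z' w i 0|))%:E < +oo)%E.
Proof.
have [_ _ _ ex] := gcZ.
have mE : measurable_fun setT (fun w : R * T => (expR (c * \sum_i `|Z' w i 0|))%:E).
  apply/measurable_EFinP; apply: measurableT_comp => //; apply: measurable_funM => //.
  by apply: measurable_sum => i; apply: measurableT_comp => //; exact: mZ'.
have mS : measurable_fun setT (fun w : T => (expR (c * \sum_i `|Z w i 0|))%:E).
  apply/measurable_EFinP; apply: measurableT_comp => //; apply: measurable_funM => //.
  by apply: measurable_sum => i; apply: measurableT_comp => //; exact: mZ.
have pE w : (0 <= (expR (c * \sum_i `|Z' w i 0|))%:E)%E by rewrite lee_fin expR_ge0.
have pS w : (0 <= (expR (c * \sum_i `|Z w i 0|))%:E)%E by rewrite lee_fin expR_ge0.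
have -> : (\int[gamma \x P]_w (expR (c * \sum_i `|Z' w i 0|))%:E =
    (\int[gamma]_x (expR (c * `|x|))%:E) * \int[P]_w (expR (c * \sum_i `|Z w i 0|))%:E)%E.
  apply: (etrans (fubini_tonelli1 (m1 := gamma) (m2 := P) _ mE pE)) => /=.
  rewrite -ge0_integralZr//; last 2 first.
  + apply/measurable_EFinP; apply: measurableT_comp => //; apply: measurable_funM => //.
  + by apply: integral_ge0 => w _.
  apply: eq_integral => x _; rewrite -ge0_integralZl//.
  apply: eq_integral => w _; rewrite /= big_ord_recl /Z' consv0 mulrDr expRD EFinM.
  by congr (_ * (expR (_ * _))%:E)%E; apply: eq_bigr => i _; rewrite consvS.
rewrite lte_mul_pinfty//; last exact: ex.
  by apply: integral_ge0 => x _; rewrite lee_fin expR_ge0.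
rewrite ge0_fin_numE; first exact: integral_normal_expR_norm.
by apply: integral_ge0 => x _; rewrite lee_fin expR_ge0.
Qed.

Lemma gaussian_calculusS : gaussian_calculus (gamma \x P)%E Z'.
Proof. by split; [exact: std_gaussianS|exact: cameron_martinS|exact: semigroupS|exact: exp_momentS]. Qed.
End step.

Lemma gaussian_calculus_exists d : exists disp (T : measurableType disp)
  (P : probability T R) (Z : T -> 'cV[R]_d), gaussian_calculus P Z.
Proof.
elim: d => [|d [disp [T [P [Z gZ]]]]].
  by exists _, _, gamma; eexists; exact: gaussian_calculus0.
by do 4 eexists; exact: (gaussian_calculusS gZ).
Qed.

End model.

(** * The l1 norm and Lipschitz functions *)
Section l1.
Context (R : realType) (d : nat).
Implicit Types (u v : 'cV[R]_d) (h : 'cV[R]_d -> R) (L : R).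

(** The l1 norm dominates the Euclidean norm, and the exponential of a multiple of
    it is a product over the coordinates; all errors are measured with it. *)
Definition l1norm v : R := \sum_i `|v i 0|.
Definition dotp u v : R := \sum_i u i 0 * v i 0.

Lemma l1norm_ge0 v : 0 <= l1norm v. Proof. by apply: sumr_ge0. Qed.

Lemma l1norm0 : l1norm 0 = 0.
Proof. by rewrite /l1norm big1// => i _; rewrite mxE normr0. Qed.

Lemma ler_l1normD u v : l1norm (u + v) <= l1norm u + l1norm v.
Proof. by rewrite /l1norm -big_split/=; apply: ler_sum => i _; rewrite mxE ler_normD. Qed.

Lemma l1normZ t v : l1norm (t *: v) = `|t| * l1norm v.
Proof. by rewrite /l1norm mulr_sumr; apply: eq_bigr => i _; rewrite mxE normrM. Qed.

Lemma l1normN v : l1norm (- v) = l1norm v.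
Proof. by apply: eq_bigr => i _; rewrite mxE normrN. Qed.

Lemma coord_le_l1norm v i : `|v i 0| <= l1norm v.
Proof. by rewrite /l1norm (bigD1 i)//= lerDl sumr_ge0. Qed.

Lemma dotp_le u v : `|dotp u v| <= l1norm u * l1norm v.
Proof.
apply: (le_trans (ler_norm_sum _ _ _)); rewrite {1}/l1norm mulr_suml.
by apply: ler_sum => i _; rewrite normrM ler_wpM2l// coord_le_l1norm.
Qed.

Definition lipschitz_l1 L h := forall u v, `|h u - h v| <= L * l1norm (u - v).

Lemma lipschitz_l1_affine L h (s : R) y : 0 <= L -> lipschitz_l1 L h ->
  lipschitz_l1 (L * `|s|) (fun v => h (y + s *: v)).
Proof.
move=> L0 hL u v; apply: (le_trans (hL _ _)).
by rewrite opprD addrACA subrr add0r -scalerBr l1normZ mulrA.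
Qed.

Lemma borel_fun_coord i : borel_fun (fun v : 'cV[R]_d => v i 0).
Proof. by move=> disp T u mu; exact: mu. Qed.

Lemma borel_fun_l1norm (a : 'cV[R]_d) : borel_fun (fun v => l1norm (v - a)).
Proof.
move=> disp T u mu; rewrite /comp; apply: measurable_sum => i; apply: measurableT_comp => //.
under eq_fun do rewrite mxE; apply: measurable_funD; [exact: mu|exact: measurable_cst].
Qed.

Lemma l1norm_dense u (e : R) : 0 < e ->
  exists q : 'cV[rat]_d, l1norm (u - map_mx ratr q) < e.
Proof.
move=> e0; pose e' := e / d.+1%:R; have e'0 : 0 < e' by rewrite divr_gt0.
have qP i : exists q : rat, ratr q \in `]u i 0, u i 0 + e'[.
  by apply: rat_in_itvoo; rewrite ltrDl.
pose q i := xchoose (qP i); exists (\col_i q i).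
apply: (@le_lt_trans _ _ (\sum_(i < d) e')).
  apply: ler_sum => i _; rewrite !mxE.
  have := xchooseP (qP i); rewrite -/(q i) in_itv/= => /andP[h1 h2].
  by rewrite distrC ger0_norm ?subr_ge0 ?(ltW h1)// lerBlDl ltW.
rewrite sumr_const card_ord -mulr_natl /e' mulrCA gtr_pMr//.
by rewrite ltr_pdivrMr// mul1r ltr_nat.
Qed.

(** A Lipschitz h is the supremum over rational q of h q - L |v - q|, so the set
    where h exceeds a is a countable union. *)
Lemma borel_fun_lipschitz L h : 0 <= L -> lipschitz_l1 L h -> borel_fun h.
Proof.
move=> L0 hL disp T u mu mD.
apply: (measurability _ (RGenOInfty.measurableE R)) => //.
move=> /= _ [_ [a ->] <-]; rewrite preimage_itvoy setTI.
pose c (q : 'cV[rat]_d) : 'cV[R]_d := map_mx ratr q.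
pose g q w := h (c q) - L * l1norm (u w - c q).
have mg q : measurable_fun setT (g q).
  apply: measurable_funB => //; apply: measurable_funM => //.
  exact: borel_fun_l1norm.
rewrite [X in measurable X](_ : _ = \bigcup_q [set w | a < g q w]).
  apply: countable_bigcupT_measurable => // q.
  by rewrite -preimage_itvoy -[X in measurable X]setTI; apply: mg.
apply/seteqP; split => w /=.
  move=> ah; pose e := (h (u w) - a) / (L *+ 2 + 1).
  have D0 : 0 < L *+ 2 + 1 by rewrite ltr_wpDl// mulrn_wge0.
  have e0 : 0 < e by rewrite divr_gt0// subr_gt0.
  have [q hq] := l1norm_dense (u w) e0; exists q => //.
  have := hL (u w) (c q); rewrite ler_norml => /andP[_].
  move: hq; rewrite -/(c q) => hq h1.
  have h2 : L * l1norm (u w - c q) <= L * e by rewrite ler_wpM2l// ltW.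
  have h3 : e * (L *+ 2 + 1) = h (u w) - a by rewrite /e divfK// gt_eqF.
  rewrite mulr2n in h3; change (a < h (c q) - L * l1norm (u w - c q)); lra.
move=> [q _] /lt_le_trans; apply; rewrite /g.
have := hL (c q) (u w); rewrite ler_norml => /andP[_].
by rewrite -[c q - u w]opprB l1normN; lra.
Qed.

End l1.

(** * Functions of exponential growth *)
Section tame.
Context (R : realType) (d : nat).
Implicit Types (u v : 'cV[R]_d) (phi psi : 'cV[R]_d -> R) (L : R).

(** An algebra of Gaussian-integrable functions which contains the Lipschitz
    functions, the polynomials and the Cameron-Martin weights. *)
Definition tame phi := borel_fun phi /\
  exists K c : R, [/\ 0 <= K, 0 <= c & forall v, `|phi v| <= K * expR (c * l1norm v)].

Lemma tame_dominated phi (K c : R) : borel_fun phi -> 0 <= K -> 0 <= c ->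
  (forall v, `|phi v| <= K * expR (c * l1norm v)) -> tame phi.
Proof. by move=> bphi K0 c0 h; split => //; exists K, c. Qed.

Lemma l1norm_le_expR v : l1norm v <= expR (1 * l1norm v).
Proof. by rewrite mul1r; apply: le_trans (expR_ge1Dx _); rewrite lerDr. Qed.

Lemma tame_cst k : tame (fun=> k).
Proof.
apply: (@tame_dominated _ `|k| 0) => //; first by move=> disp T u mu; exact: measurable_cst.
by move=> v; rewrite mul0r expR0 mulr1.
Qed.

Lemma tame_coord i : tame (fun v => v i 0).
Proof.
apply: (@tame_dominated _ 1 1) => //; first exact: borel_fun_coord.
move=> v; rewrite mul1r; apply: (le_trans (coord_le_l1norm v i)).
exact: l1norm_le_expR.
Qed.

Lemma tameD phi psi : tame phi -> tame psi -> tame (fun v => phi v + psi v).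
Proof.
move=> [b1 [K1 [c1 [K10 c10 h1]]]] [b2 [K2 [c2 [K20 c20 h2]]]].
apply: (@tame_dominated _ (K1 + K2) (c1 + c2)); rewrite ?addr_ge0//.
  by move=> disp T u mu; apply: measurable_funD; [exact: b1|exact: b2].
move=> v; apply: (le_trans (ler_normD _ _)); rewrite mulrDl lerD//.
  apply: (le_trans (h1 v)); rewrite ler_wpM2l// ler_expR ler_wpM2r ?l1norm_ge0//.
  by rewrite lerDl.
apply: (le_trans (h2 v)); rewrite ler_wpM2l// ler_expR ler_wpM2r ?l1norm_ge0//.
by rewrite lerDr.
Qed.

Lemma tameM phi psi : tame phi -> tame psi -> tame (fun v => phi v * psi v).
Proof.
move=> [b1 [K1 [c1 [K10 c10 h1]]]] [b2 [K2 [c2 [K20 c20 h2]]]].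
apply: (@tame_dominated _ (K1 * K2) (c1 + c2)); rewrite ?addr_ge0 ?mulr_ge0//.
  by move=> disp T u mu; apply: measurable_funM; [exact: b1|exact: b2].
by move=> v; rewrite normrM mulrDl expRD mulrACA ler_pM.
Qed.

Lemma tameZ k phi : tame phi -> tame (fun v => k * phi v).
Proof. exact/tameM/tame_cst. Qed.

Lemma tameB phi psi : tame phi -> tame psi -> tame (fun v => phi v - psi v).
Proof.
move=> t1 t2; rewrite (_ : (fun v => _) = (fun v => phi v + (-1) * psi v)).
  by apply: tameD => //; exact: tameZ.
by apply/funext => v; rewrite mulN1r.
Qed.

Lemma tame_sum I (s : seq I) (P : pred I) (F : I -> 'cV[R]_d -> R) :
  (forall i, P i -> tame (F i)) -> tame (fun v => \sum_(i <- s | P i) F i v).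
Proof.
move=> tF; elim: s => [|i s ih].
  rewrite (_ : (fun _ => _) = (fun=> 0)); first exact: tame_cst.
  by apply/funext => v; rewrite big_nil.
rewrite (_ : (fun _ => _) = (fun v => (if P i then F i v else 0) +
    \sum_(j <- s | P j) F j v)); last first.
  by apply/funext => v; rewrite big_cons; case: ifP => //; rewrite add0r.
have ti : tame (fun v => if P i then F i v else 0).
  by case Pi: (P i); [exact: tF|exact: tame_cst].
exact: tameD.
Qed.

Lemma tame_dotp a : tame (dotp a).
Proof. by apply: tame_sum => i _; apply: tameZ; exact: tame_coord. Qed.

Lemma borel_fun_l1 : borel_fun (@l1norm R d).
Proof.
by have := @borel_fun_l1norm R d 0; under [X in borel_fun X]eq_fun do rewrite subr0.
Qed.

Lemma tame_expR_l1norm c : 0 <= c -> tame (fun v => expR (c * l1norm v)).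
Proof.
move=> c0; apply: (@tame_dominated _ 1 c) => //.
  move=> disp T u mu; apply: (@measurableT_comp _ _ _ _ _ _ (@expR R)) => //.
  by apply: measurable_funM => //; exact: borel_fun_l1.
by move=> v; rewrite mul1r ger0_norm// expR_ge0.
Qed.

Lemma tame_l1norm : tame (@l1norm R d).
Proof.
apply: (@tame_dominated _ 1 1) => //; first exact: borel_fun_l1.
by move=> v; rewrite mul1r ger0_norm ?l1norm_ge0//; exact: l1norm_le_expR.
Qed.

Lemma tame_expR_dotp a k : tame (fun v => expR (dotp a v - k)).
Proof.
apply: (@tame_dominated _ (expR (- k)) (l1norm a)); rewrite ?expR_ge0 ?l1norm_ge0//.
  move=> disp T u mu; apply: (@measurableT_comp _ _ _ _ _ _ (@expR R)) => //.
  apply: measurable_funB => //; rewrite /comp; apply: measurable_sum => i; exact: measurable_funM.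
move=> v; rewrite ger0_norm ?expR_ge0// addrC expRD ler_wpM2l ?expR_ge0// ler_expR.
by apply: le_trans (dotp_le _ _); exact: ler_norm.
Qed.

Lemma tame_lipschitz L h : 0 <= L -> lipschitz_l1 L h -> tame h.
Proof.
move=> L0 hL; apply: (@tame_dominated _ (`|h 0| + L) 1) => //.
- exact: (borel_fun_lipschitz L0 hL).
- by rewrite addr_ge0.
move=> v; have := hL v 0; rewrite subr0 => h1.
have h2 : `|h v| <= `|h 0| + L * l1norm v.
  by rewrite -lerBlDl; apply: le_trans (lerB_dist _ _) _.
apply: (le_trans h2); rewrite mulrDl lerD//.
  by rewrite ler_peMr// mul1r -expR0 ler_expR l1norm_ge0.
by rewrite ler_wpM2l// l1norm_le_expR.
Qed.

Lemma tame_shift phi a : tame phi -> tame (fun v => phi (v + a)).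
Proof.
move=> [b1 [K1 [c1 [K10 c10 h1]]]].
apply: (@tame_dominated _ (K1 * expR (c1 * l1norm a)) c1) => //.
- move=> disp T u mu; apply: (b1 _ _ (fun w => u w + a)).
  by apply: coord_measurableD => // i; exact: measurable_cst.
- by rewrite mulr_ge0// expR_ge0.
move=> v; apply: (le_trans (h1 _)); rewrite -mulrA ler_wpM2l// -expRD ler_expR -mulrDr.
by rewrite ler_wpM2l// addrC; exact: ler_l1normD.
Qed.

Lemma tame_max0 phi : tame phi -> tame (fun v => Num.max (phi v) 0).
Proof.
move=> [b1 [K1 [c1 [K10 c10 h1]]]]; apply: (@tame_dominated _ K1 c1) => //.
  move=> disp T u mu; apply: measurable_maxr; [exact: b1|exact: measurable_cst].
move=> v; apply: le_trans (h1 v).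
have [p0|p0] := leP (phi v) 0; first by rewrite normr0.
by [].
Qed.

End tame.

(** * The Gaussian expectation as a functional *)
Section gaussian_expectation.
Context (R : realType) (d : nat).

(** The rules of calculation for the standard Gaussian expectation on which the
    rest relies; [gexp_law] links them with actual Gaussian vectors. *)
Record gaussian_expectation (E : ('cV[R]_d -> R) -> R) : Prop := GaussianExpectation {
  gexpZD : forall k phi psi, tame phi -> tame psi ->
    E (fun v => k * phi v + psi v) = k * E phi + E psi;
  gexp_le : forall phi psi, tame phi -> tame psi -> (forall v, phi v <= psi v) ->
    E phi <= E psi;
  gexp_cst : forall k, E (fun=> k) = k;
  gexp_cameron_martin : forall phi a, tame phi ->
    E (fun v => phi (v + a)) = E (fun v => phi v * expR (dotp a v - dotp a a / 2));
  gexp_semigroup : forall L h t, 0 <= L -> lipschitz_l1 L h -> 0 < t ->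
    E (fun v => E (fun u => h (t *: v + u))) = E (fun v => h (Num.sqrt (1 + t ^+ 2) *: v));
  gexp_law : forall disp (T : measurableType disp) (P : probability T R) Z phi,
    std_gaussian P Z -> tame phi -> ('E_P[phi \o Z] = (E phi)%:E)%E }.

Section construction.
Context disp (T : measurableType disp) (P : probability T R) (Z : T -> 'cV[R]_d).
Hypothesis gcZ : gaussian_calculus P Z.

Let mZ : coord_measurable Z. Proof. by have [[]] := gcZ. Qed.

Let E (phi : 'cV[R]_d -> R) := fine (\int[P]_w (phi (Z w))%:E).

Let measurable_tame phi : tame phi -> measurable_fun setT (fun w => (phi (Z w))%:E).
Proof. by move=> [b _]; apply/measurable_EFinP; exact: b. Qed.

Let integrable_tame phi : tame phi -> P.-integrable setT (fun w => (phi (Z w))%:E).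
Proof.
move=> tphi; have [b [K [c [K0 c0 h]]]] := tphi.
apply: (@le_integrable _ _ _ P _ measurableT _ (fun w => (K * expR (c * l1norm (Z w)))%:E)).
- exact: measurable_tame.
- move=> w _; rewrite lee_fin; apply: (le_trans (h _)).
  exact: ler_norm.
- under eq_fun do rewrite EFinM.
  apply: integrableZl => //; apply/integrableP; split; first exact: (measurable_tame (tame_expR_l1norm d c0)).
  under eq_integral do rewrite gee0_abs ?lee_fin ?expR_ge0//.
  by have [_ _ _] := gcZ; apply.
Qed.

Let EE phi : tame phi -> (E phi)%:E = (\int[P]_w (phi (Z w))%:E)%E.
Proof. by move=> tphi; rewrite /E fineK//; exact/integrable_fin_num/integrable_tame. Qed.

Let E_cst k : E (fun=> k) = k.
Proof. by rewrite /E integral_cst//= probability_setT mule1. Qed.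

Let E_ZD k phi psi : tame phi -> tame psi ->
  E (fun v => k * phi v + psi v) = k * E phi + E psi.
Proof.
move=> tp tq; apply: EFin_inj; rewrite EFinD EFinM !EE//; last by apply: tameD => //; exact: tameZ.
have i1 := integrable_tame tp; have i2 := integrable_tame tq.
under eq_integral do rewrite EFinD EFinM.
rewrite integralD//; last by exact: integrableZl.
by rewrite integralZl.
Qed.

Let E_le phi psi : tame phi -> tame psi -> (forall v, phi v <= psi v) ->
  E phi <= E psi.
Proof.
move=> tp tq pq; rewrite -lee_fin !EE//; apply: le_integral => //.
- exact: integrable_tame.
- exact: integrable_tame.
- by move=> w _; rewrite lee_fin.
Qed.

Let E_bound (phi : 'cV[R]_d -> R) k : tame phi -> (forall v, `|phi v| <= k) -> `|E phi| <= k.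
Proof.
move=> tp pk; rewrite ler_norml; apply/andP; split.
  rewrite -[leLHS]E_cst; apply: E_le => //; first exact: tame_cst.
  by move=> v; have := pk v; rewrite ler_norml => /andP[].
rewrite -[leRHS]E_cst; apply: E_le => //; first exact: tame_cst.
by move=> v; have := pk v; rewrite ler_norml => /andP[].
Qed.

(** The formulas for nonnegative functions extend to signed ones through positive
    and negative parts; the shape k * a + b matches [E_ZD]. *)
Let posneg (phi : 'cV[R]_d -> R) v :
  phi v = (-1) * Num.max (- phi v) 0 + Num.max (phi v) 0.
Proof.
case: (leP (phi v) 0) => h; last by rewrite max_r ?mulr0 ?add0r// oppr_le0 ltW.
by rewrite max_l ?oppr_ge0// mulN1r opprK addr0.
Qed.

Let tame_opp (phi : 'cV[R]_d -> R) : tame phi -> tame (fun v => - phi v).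
Proof.
move=> t; rewrite (_ : (fun _ => _) = (fun v => (-1) * phi v)); first exact: tameZ.
by apply/funext => v; rewrite mulN1r.
Qed.

Let E_cm0 phi a : tame phi -> (forall v, 0 <= phi v) ->
  E (fun v => phi (v + a)) = E (fun v => phi v * expR (dotp a v - dotp a a / 2)).
Proof.
move=> tp p0; apply: EFin_inj; rewrite !EE; last 2 first.
  by apply: tameM => //; exact: tame_expR_dotp.
  exact: tame_shift.
have [_ cm _ _] := gcZ; rewrite (cm (fun v => (phi v)%:E)); last 2 first.
  by move=> disp' T' u mu; apply/measurable_EFinP; exact: (proj1 tp).
  by move=> v; rewrite lee_fin.
apply: eq_integral => w _; rewrite -EFinM /dotp; congr (_ * expR (_ - _ / 2))%:E.
Qed.

Let E_cm phi a : tame phi ->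
  E (fun v => phi (v + a)) = E (fun v => phi v * expR (dotp a v - dotp a a / 2)).
Proof.
move=> tp.
have t1 : tame (fun v => Num.max (- phi v) 0) by exact/tame_max0/tame_opp.
have t2 : tame (fun v => Num.max (phi v) 0) by exact/tame_max0.
have te := tame_expR_dotp a (dotp a a / 2).
under eq_fun do rewrite (posneg phi).
rewrite (E_ZD (-1) (tame_shift a t1) (tame_shift a t2)).
rewrite (@E_cm0 _ a t1); last by move=> v; rewrite le_max lexx orbT.
rewrite (@E_cm0 _ a t2); last by move=> v; rewrite le_max lexx orbT.
rewrite -(E_ZD (-1) (tameM t1 te) (tameM t2 te)); congr E; apply/funext => v.
by rewrite [in RHS](posneg phi) mulrDl mulrA.
Qed.

(** This makes the inner expectation of the semigroup formula a tame function. *)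
Let lipschitz_sg L h t : 0 <= L -> lipschitz_l1 L h ->
  lipschitz_l1 (L * `|t|) (fun v => E (fun u => h (t *: v + u))).
Proof.
move=> L0 hL v v'.
have th x : tame (fun u => h (t *: x + u)).
  apply: (@tame_lipschitz _ _ (L * `|1|)); first by rewrite mulr_ge0.
  by have := lipschitz_l1_affine 1 (t *: x) L0 hL; under eq_fun do rewrite scale1r.
have k u : `|h (t *: v + u) - h (t *: v' + u)| <= L * `|t| * l1norm (v - v').
  apply: (le_trans (hL _ _)); rewrite opprD addrACA subrr addr0 -scalerBr l1normZ.
  by rewrite mulrA.
have e x y : E (fun u => h (t *: x + u)) - E (fun u => h (t *: y + u)) =
    E (fun u => h (t *: x + u) - h (t *: y + u)).
  transitivity (E (fun u => (-1) * h (t *: y + u) + h (t *: x + u))).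
    by rewrite E_ZD// mulN1r addrC.
  by congr E; apply/funext => u; rewrite mulN1r addrC.
rewrite e; apply: E_bound => //; exact: tameB.
Qed.

Let E_sg0 L h t : 0 <= L -> lipschitz_l1 L h -> (forall v, 0 <= h v) -> 0 < t ->
  E (fun v => E (fun u => h (t *: v + u))) = E (fun v => h (Num.sqrt (1 + t ^+ 2) *: v)).
Proof.
move=> L0 hL h0 t0.
have th (s : R) x : tame (fun u => h (x + s *: u)).
  apply: (@tame_lipschitz _ _ (L * `|s|)); first by rewrite mulr_ge0.
  exact: lipschitz_l1_affine.
have t1 : tame (fun v => h (Num.sqrt (1 + t ^+ 2) *: v)).
  by have := th (Num.sqrt (1 + t ^+ 2)) 0; under eq_fun do rewrite add0r.
have t2 x : tame (fun u => h (x + u)).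
  by have := th 1 x; under eq_fun do rewrite scale1r.
have Lt0 : 0 <= L * `|t| by rewrite mulr_ge0.
apply: EFin_inj; rewrite !EE//; last exact: (tame_lipschitz Lt0 (lipschitz_sg t L0 hL)).
have [_ _ sg _] := gcZ; rewrite -(sg (fun v => (h v)%:E))//; last first.
  move=> disp' T' u mu; apply/measurable_EFinP.
  exact: (borel_fun_lipschitz L0 hL).
apply: eq_integral => w _; exact: EE.
Qed.

Let E_sg L h t : 0 <= L -> lipschitz_l1 L h -> 0 < t ->
  E (fun v => E (fun u => h (t *: v + u))) = E (fun v => h (Num.sqrt (1 + t ^+ 2) *: v)).
Proof.
move=> L0 hL t0.
have lmax (g : 'cV[R]_d -> R) : lipschitz_l1 L g -> lipschitz_l1 L (fun v => Num.max (g v) 0).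
  move=> gL u v; apply: le_trans (gL u v).
  rewrite !ler_norml; case: (leP (g u) 0) => hu; case: (leP (g v) 0) => hv;
    have := ler_norm (g u - g v); have := ler_norm (g v - g u);
    rewrite distrC; lra.
have hn : lipschitz_l1 L (fun v => - h v).
  by move=> u v; rewrite -opprD normrN; exact: hL.
have L1 := lmax _ hL; have L2 := lmax _ hn.
have Lt0 : 0 <= L * `|t| by rewrite mulr_ge0.
have th (g : 'cV[R]_d -> R) (s : R) x : lipschitz_l1 L g -> tame (fun u => g (x + s *: u)).
  move=> gL; apply: (@tame_lipschitz _ _ (L * `|s|)); first by rewrite mulr_ge0.
  exact: lipschitz_l1_affine.
have t1 (g : 'cV[R]_d -> R) s : lipschitz_l1 L g -> tame (fun v => g (s *: v)).
  by move=> gL; have := th g s 0 gL; under eq_fun do rewrite add0r.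
have t2 (g : 'cV[R]_d -> R) x : lipschitz_l1 L g -> tame (fun u => g (x + u)).
  by move=> gL; have := th g 1 x gL; under eq_fun do rewrite scale1r.
have e1 v : E (fun u => h (t *: v + u)) =
   (-1) * E (fun u => Num.max (- h (t *: v + u)) 0) + E (fun u => Num.max (h (t *: v + u)) 0).
  rewrite -E_ZD; last 2 first.
    exact: (t2 _ _ L2).
    exact: (t2 _ _ L1).
  by congr E; apply/funext => u; exact: (posneg h).
under eq_fun do rewrite e1.
rewrite E_ZD; last 2 first.
  exact: (tame_lipschitz Lt0 (lipschitz_sg t L0 L2)).
  exact: (tame_lipschitz Lt0 (lipschitz_sg t L0 L1)).
rewrite (E_sg0 L0 L1)//; last by move=> v; rewrite le_max lexx orbT.
rewrite (E_sg0 L0 L2)//; last by move=> v; rewrite le_max lexx orbT.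
rewrite -E_ZD; last 2 first.
  exact: (t1 _ _ L2).
  exact: (t1 _ _ L1).
by congr E; apply/funext => u; rewrite -(posneg h).
Qed.

Let E_law disp' (T' : measurableType disp') (P' : probability T' R) Z' phi :
    std_gaussian P' Z' -> tame phi -> ('E_P'[phi \o Z'] = (E phi)%:E)%E.
Proof.
move=> g' tp; rewrite EE// unlock integralE [RHS]integralE.
have [g _ _ _] := gcZ.
have law (psi : 'cV[R]_d -> R) : tame psi -> (forall v, 0 <= psi v) ->
    (\int[P']_w (psi (Z' w))%:E = \int[P]_w (psi (Z w))%:E)%E.
  move=> tpsi psi0; apply: (@std_gaussian_law R d _ _ P' Z' _ _ P Z (fun v => (psi v)%:E)) => //.
  by move=> ? ? u mu; apply/measurable_EFinP; exact: (proj1 tpsi).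
have max0 (q : 'cV[R]_d -> R) v : 0 <= Num.max (q v) 0 by rewrite le_max lexx orbT.
have h1 := law _ (tame_max0 tp) (max0 phi).
have h2 := law _ (tame_max0 (tame_opp tp)) (max0 (fun v => - phi v)).
congr (_ - _)%E.
  by rewrite (eq_integral (fun w => (Num.max (phi (Z' w)) 0)%:E)) 1?h1;
    [apply: eq_integral|]; move=> w _; rewrite funeposE EFin_max.
by rewrite (eq_integral (fun w => (Num.max (- phi (Z' w)) 0)%:E)) 1?h2;
  [apply: eq_integral|]; move=> w _; rewrite funenegE EFin_max.
Qed.

Lemma gaussian_calculus_expectation : gaussian_expectation E.
Proof.
split; [exact: E_ZD|exact: E_le|exact: E_cst|exact: E_cm|exact: E_sg|exact: E_law].
Qed.

End construction.

Lemma gaussian_expectation_exists : exists E, gaussian_expectation E.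
Proof.
have [disp [T [P [Z gZ]]]] := gaussian_calculus_exists R d.
by eexists; exact: (gaussian_calculus_expectation gZ).
Qed.

End gaussian_expectation.

(** * Quadratic expansion of the exponential *)
Section exponential.
Context (R : realType).
Implicit Types x w : R.

Lemma expR_ge_pow n x : 0 <= x -> x ^+ n <= n`!%:R * expR x.
Proof.
case: n => [|n] x0.
  by rewrite expr0 fact0 mul1r -expR0 ler_expR.
have h := expR_ge1Dxn n x0.
have f0 : 0 < (n.+1)`!%:R :> R by rewrite ltr0n fact_gt0.
rewrite mulrC -ler_pdivrMr//; apply: le_trans h; by rewrite lerDr.
Qed.

(** Beyond rank 2 the terms of the exponential series of w are dominated by
    |w| ^ 3 times those of the series of |w|, because k! <= (k + 3)!. *)
Lemma expR_taylor2 w : `|expR w - 1 - w - w ^+ 2 / 2| <= `|w| ^+ 3 * expR `|w|.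
Proof.
have cv : (fun N => series (exp_coeff w) (N + 3)%N - 1 - w - w ^+ 2 / 2) @ \oo -->
    expR w - 1 - w - w ^+ 2 / 2.
  do 3 (apply: cvgB; last exact: cvg_cst).
  by rewrite (cvg_shiftn 3); exact: is_cvg_series_exp_coeff.
have cvn : (fun N => `|series (exp_coeff w) (N + 3)%N - 1 - w - w ^+ 2 / 2|) @ \oo -->
    `|expR w - 1 - w - w ^+ 2 / 2| by exact: cvg_norm.
rewrite -(cvg_lim _ cvn)//; apply: limr_le; first by apply/cvg_ex; eexists; exact: cvn.
apply: nearW => N.
have -> : series (exp_coeff w) (N + 3)%N - 1 - w - w ^+ 2 / 2 =
    \sum_(0 <= k < N) w ^+ k.+3 / (k.+3)`!%:R.
  rewrite /series/= addn3 !big_nat_recl// /exp_coeff/=.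
  rewrite fact0 (_ : 1`! = 1)%N// (_ : 2`! = 2)%N// expr0 expr1.
  by set S := \sum_(_ <= _ < _) _; field.
apply: (le_trans (ler_norm_sum _ _ _)).
have le1 : \sum_(0 <= k < N) exp_coeff `|w| k <= expR `|w|.
  apply: (nondecreasing_cvgn_le _ (is_cvg_series_exp_coeff `|w|) N).
  apply/nondecreasing_seqP => n; rewrite /series/= big_nat_recr//= lerDl.
  by rewrite /exp_coeff/= divr_ge0 ?exprn_ge0.
apply: le_trans (ler_wpM2l _ le1); last by rewrite exprn_ge0.
rewrite mulr_sumr !big_mkord; apply: ler_sum => k _.
rewrite /exp_coeff/= normrM normrX normfV [X in _ / X]ger0_norm// mulrA -exprD add3n.
rewrite ler_wpM2l ?exprn_ge0// lef_pV2 ?posrE ?ltr0n ?fact_gt0//.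
by rewrite ler_nat leq_fact// !leqW.
Qed.

(** With x = <b, z>, q = |b|^2 and l = |z| this expands the Cameron-Martin weight of
    a small shift b to second order in b. In the square of x - q / 2 the terms
    other than x^2 are already cubic in b. *)
Lemma expR_quadratic (b l x q : R) : 0 <= b <= 1 -> 0 <= l -> `|x| <= b * l ->
  0 <= q <= b ^+ 2 ->
  `|expR (x - q / 2) - (1 + x + (x ^+ 2 - q) / 2)| <= 7 * b ^+ 3 * expR (2 * (l + 1)).
Proof.
move=> /andP[b0 b1] l0 xb /andP[q0 qb].
pose w := x - q / 2.
have l1 : 0 <= l + 1 by lra.
have wb : `|w| <= b * (l + 1).
  apply: (le_trans (ler_normB _ _)); rewrite mulrDr lerD// mulr1 ger0_norm ?divr_ge0//.
  have : b ^+ 2 <= b by rewrite expr2 ler_piMl.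
  lra.
have wl : `|w| <= l + 1 by apply: (le_trans wb); rewrite ler_piMl.
have e1 : expR (l + 1) <= expR (2 * (l + 1)) by rewrite ler_expR; lra.
have e2 : expR (2 * (l + 1)) = expR (l + 1) * expR (l + 1).
  by rewrite -expRD; congr expR; ring.
have t1 : `|expR w - 1 - w - w ^+ 2 / 2| <= b ^+ 3 * (6 * expR (2 * (l + 1))).
  apply: (le_trans (expR_taylor2 w)).
  apply: (@le_trans _ _ ((b * (l + 1)) ^+ 3 * expR (l + 1))).
    by apply: ler_pM; rewrite ?exprn_ge0 ?expR_ge0 ?ler_expR// lerXn2r ?nnegrE// mulr_ge0.
  rewrite exprMn -mulrA ler_wpM2l ?exprn_ge0// e2 mulrA ler_wpM2r ?expR_ge0//.
  exact: (expR_ge_pow 3 l1).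
have b3 : 0 <= b ^+ 3 by rewrite exprn_ge0.
have t2 : `|q ^+ 2 / 8 - x * q / 2| <= b ^+ 3 * expR (2 * (l + 1)).
  have h1 : `|x * q| <= b ^+ 3 * l.
    rewrite normrM (ger0_norm q0) (_ : b ^+ 3 * l = (b * l) * b ^+ 2); last by ring.
    by apply: ler_pM.
  have h2 : q ^+ 2 <= b ^+ 3.
    apply: (@le_trans _ _ ((b ^+ 2) ^+ 2)); first by rewrite lerXn2r ?nnegrE ?sqr_ge0.
    by rewrite -exprM exprS ler_piMl.
  have h3 : l + 1 <= expR (2 * (l + 1)).
    by apply: le_trans e1; apply: le_trans (expR_ge1Dx _); rewrite lerDr.
  have h4 : b ^+ 3 * (l + 1) <= b ^+ 3 * expR (2 * (l + 1)) by rewrite ler_wpM2l.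
  move: h1; rewrite !ler_norml => /andP[h1 h1']; rewrite mulrDr mulr1 in h4.
  have := sqr_ge0 q; have : 0 <= b ^+ 3 * l by rewrite mulr_ge0.
  by move=> ? ?; apply/andP; split; lra.
have -> : expR (x - q / 2) - (1 + x + (x ^+ 2 - q) / 2) =
    (expR w - 1 - w - w ^+ 2 / 2) + (q ^+ 2 / 8 - x * q / 2).
  by rewrite /w; field.
apply: (le_trans (ler_normD _ _)); lra.
Qed.

(** Dividing by s and letting s tend to 0 gives A = 0; dividing once more gives
    B = 0. *)
Lemma cubic_small_coef (A B K s0 : R) : 0 < s0 -> 0 <= K ->
  (forall s, 0 < s <= s0 -> `|s * A + s ^+ 2 * B| <= K * s ^+ 3) -> A = 0 /\ B = 0.
Proof.
move=> s00 K0 h.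
have h1 s : 0 < s <= s0 -> `|A + s * B| <= K * s ^+ 2.
  move=> /andP[sp sl]; have := h s; rewrite sp sl => /(_ isT).
  rewrite (_ : s * A + s ^+ 2 * B = s * (A + s * B)); last by ring.
  rewrite normrM (gtr0_norm sp) (_ : K * s ^+ 3 = s * (K * s ^+ 2)); last by ring.
  by rewrite ler_pM2l.
have null (x c : R) : 0 <= c -> (forall s, 0 < s <= s0 -> s <= 1 -> `|x| <= c * s) -> x = 0.
  move=> c0 hx; apply/eqP; rewrite -normr_le0 leNgt; apply/negP => x0.
  pose s := Num.min (Num.min s0 1) (`|x| / (2 * (c + 1))).
  have d0 : 0 < 2 * (c + 1) by rewrite mulr_gt0// ltr_wpDl.
  have sp : 0 < s by rewrite !lt_min s00 ltr01 divr_gt0.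
  have ss0 : s <= s0 by rewrite !ge_min lexx.
  have s1 : s <= 1 by rewrite !ge_min lexx orbT.
  have sx : s <= `|x| / (2 * (c + 1)) by rewrite ge_min lexx orbT.
  rewrite ler_pdivlMr// in sx.
  have := hx s; rewrite sp ss0 => /(_ isT s1); nra.
have A0 : A = 0.
  apply: (null _ (`|B| + K)); first by rewrite addr_ge0.
  move=> s hs s1; have [sp _] := andP hs.
  have -> : A = (A + s * B) - s * B by ring.
  apply: (le_trans (ler_normB _ _)); rewrite normrM (gtr0_norm sp) mulrDl addrC.
  rewrite (mulrC `|B|) lerD2l; apply: (le_trans (h1 s hs)).
  by rewrite ler_wpM2l// expr2 ler_piMl// ltW.
split=> //; apply: (null _ K K0) => s hs s1; have [sp _] := andP hs.
have := h1 s hs; rewrite A0 add0r normrM (gtr0_norm sp) expr2 mulrCA.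
by rewrite ler_pM2l.
Qed.

End exponential.

(** * Gaussian moments *)
Section gaussian_moments.
Context (R : realType) (d : nat) (E : ('cV[R]_d -> R) -> R).
Hypothesis hE : gaussian_expectation E.
Implicit Types (phi psi : 'cV[R]_d -> R).

Let tame_cst := @tame_cst R d.

Lemma gexpD phi psi : tame phi -> tame psi -> E (fun v => phi v + psi v) = E phi + E psi.
Proof.
move=> tp tq; rewrite -[in RHS](mul1r (E phi)) -(gexpZD hE)//.
by congr E; apply/funext => v; rewrite mul1r.
Qed.

Lemma gexpZ k phi : tame phi -> E (fun v => k * phi v) = k * E phi.
Proof.
move=> tp; rewrite -[RHS]addr0 -(gexp_cst hE 0) -(gexpZD hE)//.
by congr E; apply/funext => v; rewrite addr0.
Qed.

Lemma gexpZr k phi : tame phi -> E (fun v => phi v * k) = E phi * k.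
Proof. by move=> tp; rewrite mulrC -gexpZ//; congr E; apply/funext => v; rewrite mulrC. Qed.

Lemma gexpB phi psi : tame phi -> tame psi -> E (fun v => phi v - psi v) = E phi - E psi.
Proof.
move=> tp tq; rewrite -mulN1r -gexpZ// -gexpD//; last exact: tameZ.
by congr E; apply/funext => v; rewrite mulN1r.
Qed.

Lemma gexp_sum I (s : seq I) (P : pred I) (F : I -> 'cV[R]_d -> R) :
  (forall i, tame (F i)) ->
  E (fun v => \sum_(i <- s | P i) F i v) = \sum_(i <- s | P i) E (F i).
Proof.
move=> tF; elim: s => [|i s ih].
  by rewrite big_nil -[RHS](gexp_cst hE); congr E; apply/funext => v; rewrite big_nil.
rewrite big_cons -ih; case: ifPn => Pi; last first.
  by congr E; apply/funext => v; rewrite big_cons (negbTE Pi).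
rewrite -gexpD//; last by apply: tame_sum => j _; exact: tF.
by congr E; apply/funext => v; rewrite big_cons Pi.
Qed.

Lemma gexp_norm_le phi psi : tame phi -> tame psi -> (forall v, `|phi v| <= psi v) ->
  `|E phi| <= E psi.
Proof.
move=> tp tq h; rewrite ler_norml; apply/andP; split.
  rewrite -mulN1r -gexpZ//; apply: (gexp_le hE) => //; first exact: tameZ.
  by move=> v; have := h v; rewrite ler_norml mulN1r => /andP[].
by apply: (gexp_le hE) => // v; have := h v; rewrite ler_norml => /andP[].
Qed.

Lemma gexp_ge0 phi : tame phi -> (forall v, 0 <= phi v) -> 0 <= E phi.
Proof. by move=> tp h; rewrite -(gexp_cst hE 0); apply: (gexp_le hE). Qed.

(** The exponential moments that enter the error constants. *)
Definition expl1 (c : R) := E (fun v => expR (c * l1norm v)).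

Lemma expl1_ge0 c : 0 <= c -> 0 <= expl1 c.
Proof. by move=> c0; apply: gexp_ge0 => [|v]; [exact: tame_expR_l1norm|exact: expR_ge0]. Qed.

Lemma dotp_ge0 (b : 'cV[R]_d) : 0 <= dotp b b.
Proof. by apply: sumr_ge0 => i _; rewrite -expr2 sqr_ge0. Qed.

Lemma dotp_self_le (b : 'cV[R]_d) : dotp b b <= l1norm b ^+ 2.
Proof. by apply: (le_trans (ler_norm _)); rewrite expr2; exact: dotp_le. Qed.

Lemma dotpZl s (b v : 'cV[R]_d) : dotp (s *: b) v = s * dotp b v.
Proof. by rewrite /dotp mulr_sumr; apply: eq_bigr => i _; rewrite mxE mulrA. Qed.

Lemma dotpZr s (b v : 'cV[R]_d) : dotp b (s *: v) = s * dotp b v.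
Proof. by rewrite /dotp mulr_sumr; apply: eq_bigr => i _; rewrite mxE mulrCA. Qed.

Lemma dotpDl (a b v : 'cV[R]_d) : dotp (a + b) v = dotp a v + dotp b v.
Proof. by rewrite /dotp -big_split/=; apply: eq_bigr => i _; rewrite mxE mulrDl. Qed.

Lemma tame_sqr_dotp b : tame (fun v : 'cV[R]_d => dotp b v ^+ 2).
Proof. exact: (tameM (tame_dotp b) (tame_dotp b)). Qed.

(** The Cameron-Martin weight of the shift s c has mean 1 and is within O(s^3) in
    mean of its quadratic part, of mean 1 + s E<c, z> + s^2 (E<c, z>^2 - |c|^2) / 2,
    where E<c, z>^2 is a second moment. *)
Lemma gexp_dotp (c : 'cV[R]_d) :
  E (dotp c) = 0 /\ E (fun v => dotp c v ^+ 2) = dotp c c.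
Proof.
pose K := 7 * l1norm c ^+ 3 * (expR 2 * expl1 2).
have tdc := tame_dotp c; have tdc2 := tame_sqr_dotp c.
have [] // := @cubic_small_coef R (E (dotp c)) ((E (fun v => dotp c v ^+ 2) - dotp c c) / 2)
  K (1 + l1norm c)^-1; last first.
- move=> -> h; split=> //; apply/eqP; rewrite -subr_eq0; apply/eqP.
  by move: h => /(congr1 ( *%R 2)); rewrite mulr0 mulrCA divff// mulr1.
- move=> s /andP[s0 s1].
  have l0 := l1norm_ge0 c.
  have sl : s * l1norm c <= 1.
    have : s * (1 + l1norm c) <= 1 by rewrite -ler_pdivlMr ?div1r// ltr_pwDl.
    by rewrite mulrDr mulr1; lra.
  have b01 : 0 <= s * l1norm c <= 1 by rewrite sl mulr_ge0// ltW.
  have te := tame_expR_dotp (s *: c) (dotp (s *: c) (s *: c) / 2).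
  have tq : tame (fun v => 1 + s * dotp c v + (s ^+ 2 * dotp c v ^+ 2 - s ^+ 2 * dotp c c) / 2).
    apply: tameD; first by apply: tameD; [exact: tame_cst|exact: tameZ].
    by apply: tameM; [apply: tameB; [exact: tameZ|]|]; exact: tame_cst.
  have -> : s * E (dotp c) + s ^+ 2 * ((E (fun v => dotp c v ^+ 2) - dotp c c) / 2) =
      - E (fun v => expR (dotp (s *: c) v - dotp (s *: c) (s *: c) / 2) -
        (1 + s * dotp c v + (s ^+ 2 * dotp c v ^+ 2 - s ^+ 2 * dotp c c) / 2)).
    have cm := gexp_cameron_martin hE (s *: c) (tame_cst 1).
    rewrite (gexp_cst hE) in cm.
    have -> : E (fun v => expR (dotp (s *: c) v - dotp (s *: c) (s *: c) / 2) -
        (1 + s * dotp c v + (s ^+ 2 * dotp c v ^+ 2 - s ^+ 2 * dotp c c) / 2)) =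
      1 - E (fun v => 1 + s * dotp c v + (s ^+ 2 * dotp c v ^+ 2 - s ^+ 2 * dotp c c) / 2).
      rewrite gexpB//; congr (_ - _); rewrite [RHS]cm; congr E; apply/funext => v.
      by rewrite mul1r.
    rewrite gexpD; last 2 first.
      by apply: tameD; [exact: tame_cst|exact: tameZ].
      by apply: tameM; [apply: tameB; [exact: tameZ|]|]; exact: tame_cst.
    rewrite gexpD; [|exact: tame_cst|exact: tameZ].
    rewrite gexpZr; last by apply: tameB; [exact: tameZ|exact: tame_cst].
    rewrite gexpB; [|exact: tameZ|exact: tame_cst].
    by rewrite !gexpZ// !(gexp_cst hE); field.
  rewrite normrN.
  apply: (@le_trans _ _ (E (fun v => (7 * (s * l1norm c) ^+ 3 * expR 2) * expR (2 * l1norm v)))).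
    apply: gexp_norm_le; first exact: tameB.
      by apply: tameZ; exact: tame_expR_l1norm.
    move=> v; rewrite -mulrA -expRD (_ : 2 + _ = 2 * (l1norm v + 1)); last by ring.
    have := @expR_quadratic R (s * l1norm c) (l1norm v) (dotp (s *: c) v) (dotp (s *: c) (s *: c)).
    rewrite !dotpZl dotpZr; move/(_ b01 (l1norm_ge0 _)).
    have -> : (s * dotp c v) ^+ 2 - s * (s * dotp c c) = s ^+ 2 * dotp c v ^+ 2 - s ^+ 2 * dotp c c by ring.
    apply.
      by rewrite normrM (gtr0_norm s0) -mulrA ler_pM2l// dotp_le.
    rewrite mulrA -expr2 mulr_ge0 ?sqr_ge0 ?dotp_ge0//= exprMn ler_wpM2l ?sqr_ge0//.
    exact: dotp_self_le.
  rewrite gexpZ; last exact: tame_expR_l1norm.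
  by rewrite /K /expl1 exprMn; rewrite le_eqVlt; apply/orP; left; apply/eqP; ring.
- by rewrite /K !mulr_ge0 ?exprn_ge0 ?l1norm_ge0 ?expR_ge0 ?expl1_ge0.
- by rewrite invr_gt0 ltr_pwDl// l1norm_ge0.
Qed.

Lemma dotp_delta i (v : 'cV[R]_d) : dotp (delta_mx i 0) v = v i 0.
Proof.
rewrite /dotp (bigD1 i)//= big1 => [|j ji]; first by rewrite mxE !eqxx mul1r addr0.
by rewrite mxE (negbTE ji) mul0r.
Qed.

Lemma gexp_coord i : E (fun v => v i 0) = 0.
Proof.
have [h _] := gexp_dotp (delta_mx i 0); rewrite -[RHS]h; congr E.
by apply/funext => v; rewrite dotp_delta.
Qed.

(** Polarization. *)
Lemma gexp_coord2 i j : E (fun v => v i 0 * v j 0) = (i == j)%:R.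
Proof.
have tc k := @tame_coord R d k.
have ii k : E (fun v => v k 0 * v k 0) = 1.
  have [_ h] := gexp_dotp (delta_mx k 0); rewrite dotp_delta mxE !eqxx in h.
  by rewrite -[RHS]h; congr E; apply/funext => v; rewrite dotp_delta expr2.
case: eqVneq => [->|ij]; first exact: ii.
have [_ h] := gexp_dotp (delta_mx i 0 + delta_mx j 0).
rewrite dotpDl !dotp_delta !mxE !eqxx (negbTE ij) eq_sym (negbTE ij)/= in h.
have e : E (fun v => dotp (delta_mx i 0 + delta_mx j 0) v ^+ 2) =
    E (fun v => v i 0 * v i 0 + (2 * (v i 0 * v j 0) + v j 0 * v j 0)).
  by congr E; apply/funext => v; rewrite dotpDl !dotp_delta; ring.
have tij := tameM (tc i) (tc j).
rewrite e gexpD ?gexpD ?gexpZ ?ii// in h; do ?[exact: tameM|exact: tameZ];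
  last by apply: tameD; [exact: tameZ|exact: tameM].
rewrite mulr0n; lra.
Qed.

End gaussian_moments.

(** * Gaussian smoothing of Lipschitz functions *)
Section smoothing.
Context (R : realType) (d : nat) (E : ('cV[R]_d -> R) -> R).
Hypothesis hE : gaussian_expectation E.

Notation K c := (expl1 E c).

(** One summand for each case of [smooth_quadratic]; the factor 6, also contained
    in 42 = 7 * 6, comes from l ^ 3 <= 6 exp l. *)
Definition smooth_const : R := 42 * expR 2 * K 4 + 6 * (1 + 2 * K 1 + 4 * K 1).

Lemma smooth_const_ge0 : 0 <= smooth_const.
Proof.
have k1 := expl1_ge0 hE (ler0n R 1); have k4 := expl1_ge0 hE (ler0n R 4).
by rewrite /smooth_const !(addr_ge0, mulr_ge0, expR_ge0).
Qed.

Lemma tame_smooth (L : R) h t y : 0 <= L -> lipschitz_l1 L h ->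
  tame (fun z : 'cV[R]_d => h (y + t *: z)).
Proof.
move=> L0 hL; apply: (@tame_lipschitz _ _ (L * `|t|)); first by rewrite mulr_ge0.
exact: lipschitz_l1_affine.
Qed.

Lemma sum_coord2 (b z : 'cV[R]_d) :
  \sum_i \sum_j (z i 0 * z j 0 - (i == j)%:R) * (b i 0 * b j 0) =
  dotp b z ^+ 2 - dotp b b.
Proof.
rewrite /dotp expr2 mulr_suml -sumrB; apply: eq_bigr => i _.
rewrite mulr_sumr.
under eq_bigr do rewrite mulrBl.
rewrite sumrB; congr (_ - _); first by apply: eq_bigr => j _; ring.
rewrite (bigD1 i)//= eqxx mul1r big1 ?addr0// => j ji.
by rewrite eq_sym (negbTE ji) mul0r.
Qed.

(** Smoothing at scale t makes a Lipschitz function close to a quadratic polynomial.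
    By the Cameron-Martin formula, moving the centre by a multiplies the Gaussian
    weight by that of the shift b = a / t; the expansion of this weight to second
    order in b gives the polynomial. The remainder is of order |b|^3, and it is
    integrated against h (y + t z) - h y, of order L t |z|: this yields
    L |a|^3 / t^2. The exponential in place of |a|^3 keeps the bound integrable
    under the Gaussian law. *)
Lemma smooth_quadratic (L : R) h t y : 0 <= L -> lipschitz_l1 L h -> 1 <= t ->
  exists (c0 : R) (D : 'I_d -> R) (H : 'I_d -> 'I_d -> R),
    (forall i j, H i j = H j i) /\
    forall a, `|E (fun z => h (y + a + t *: z)) -
       (c0 + \sum_i D i * a i 0 + \sum_i \sum_j H i j * (a i 0 * a j 0))| <=
       smooth_const * L * expR (l1norm a) / t ^+ 2.
Proof.
move=> L0 hL t1; have t0 : 0 < t by rewrite (lt_le_trans ltr01).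
have tn0 : t != 0 by rewrite gt_eqF.
pose g z := h (y + t *: z) - h y.
have tg : tame g.
  by apply: tameB; [exact: (tame_smooth _ _ L0 hL)|exact: tame_cst].
have gl z : `|g z| <= L * t * l1norm z.
  apply: (le_trans (hL _ _)).
  by rewrite addrAC subrr add0r l1normZ gtr0_norm// mulrA.
have tc i := @tame_coord R d i.
have tz2 i j : tame (fun z : 'cV[R]_d => z i 0 * z j 0 - (i == j)%:R).
  by apply: tameB; [exact: tameM|exact: tame_cst].
pose D i := t^-1 * E (fun z => g z * z i 0).
pose H i j := t ^- 2 / 2 * E (fun z => g z * (z i 0 * z j 0 - (i == j)%:R)).
exists (E (fun z => h (y + t *: z))), D, H; split=> [i j|a].
  by rewrite /H eq_sym; congr (_ * E _); apply/funext => z; rewrite (mulrC (z i 0)).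
pose b := t^-1 *: a.
have aE i : a i 0 = t * b i 0 by rewrite /b mxE mulrA divff// mul1r.
have l1a : l1norm a = t * l1norm b.
  by rewrite /b l1normZ gtr0_norm ?invr_gt0// mulrA divff// mul1r.
have DE : \sum_i D i * a i 0 = E (fun z => g z * dotp b z).
  transitivity (E (fun z => \sum_i (g z * z i 0) * b i 0)).
    rewrite (gexp_sum hE); last by move=> i; do ![apply: tameM => //]; exact: tame_cst.
    apply: eq_bigr => i _; rewrite (gexpZr hE); last exact: tameM.
    by rewrite /D aE; field.
  congr E; apply/funext => z; rewrite /dotp mulr_sumr.
  by apply: eq_bigr => i _; ring.
have HE : \sum_i \sum_j H i j * (a i 0 * a j 0) =
    E (fun z => g z * (dotp b z ^+ 2 - dotp b b)) / 2.
  transitivity (E (fun z => \sum_i \sum_j (g z * (z i 0 * z j 0 - (i == j)%:R)) * (b i 0 * b j 0)) / 2).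
    rewrite (gexp_sum hE); last first.
      by move=> i; apply: tame_sum => j _; apply: tameM; [exact: tameM|exact: tame_cst].
    rewrite mulr_suml; apply: eq_bigr => i _.
    rewrite (gexp_sum hE); last by move=> j; apply: tameM; [exact: tameM|exact: tame_cst].
    rewrite mulr_suml; apply: eq_bigr => j _; rewrite (gexpZr hE); last exact: tameM.
    by rewrite /H !aE; field.
  congr (_ / 2); congr E; apply/funext => z; rewrite -sum_coord2 mulr_sumr.
  apply: eq_bigr => i _; rewrite mulr_sumr; apply: eq_bigr => j _; ring.
rewrite DE HE.
have tdb := tame_dotp b; have tdb2 := tame_sqr_dotp b.
have tgd := tameM tg tdb.
have tgd2 : tame (fun z => g z * (dotp b z ^+ 2 - dotp b b)).
  by apply: tameM => //; apply: tameB => //; exact: tame_cst.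
have lb0 := l1norm_ge0 b.
have k1 := expl1_ge0 hE (ler0n R 1); have k4 := expl1_ge0 hE (ler0n R 4).
have hya : forall z, y + a + t *: z = y + t *: (z + b).
  by move=> z; rewrite scalerDr /b scalerA divff// scale1r -addrA (addrC a).
have tha : tame (fun z => h (y + a + t *: z)) by exact: (tame_smooth _ _ L0 hL).
have thy : tame (fun z => h (y + t *: z)) by exact: (tame_smooth _ _ L0 hL).
have la3 : l1norm a ^+ 3 <= 6 * expR (l1norm a).
  exact: (expR_ge_pow 3 (l1norm_ge0 a)).
have [b1|b1] := leP (l1norm b) 1.
(* A shift with |b| <= 1: the remainder of the weight is cubic in b. *)
- pose e z := expR (dotp b z - dotp b b / 2).
  have te : tame e by exact: tame_expR_dotp.
  pose q z := 1 + dotp b z + (dotp b z ^+ 2 - dotp b b) / 2.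
  have tq : tame q.
    apply: tameD; first by apply: tameD => //; exact: tame_cst.
    by apply: tameM; [apply: tameB => //|]; exact: tame_cst.
  have e1 : E (fun z => h (y + a + t *: z)) = h y + E (fun z => g z * e z).
    rewrite -(gexp_cameron_martin hE)// -{1}(gexp_cst hE (h y)) -(gexpD hE).
    + by congr E; apply/funext => z; rewrite hya /g; ring.
    + exact: tame_cst.
    + exact: tame_shift.
  have e2 : E (fun z => h (y + t *: z)) = h y + E g.
    rewrite -{1}(gexp_cst hE (h y)) -(gexpD hE)//; last exact: tame_cst.
    by congr E; apply/funext => z; rewrite /g; ring.
  have -> : E (fun z => h (y + a + t *: z)) -
      (E (fun z => h (y + t *: z)) + E (fun z => g z * dotp b z) +
       E (fun z => g z * (dotp b z ^+ 2 - dotp b b)) / 2) =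
      E (fun z => g z * (e z - q z)).
    rewrite e1 e2 -(gexpZr hE)//.
    transitivity (E (fun z => g z * e z) - E (fun z => (g z + g z * dotp b z) +
        g z * (dotp b z ^+ 2 - dotp b b) / 2)).
      rewrite (gexpD hE); [|exact: tameD|by apply: tameM => //; exact: tame_cst].
      by rewrite (gexpD hE)//; ring.
    rewrite -(gexpB hE); last 2 first.
    + exact: tameM.
    + apply: tameD; first exact: tameD.
      by apply: tameM => //; exact: tame_cst.
    by congr E; apply/funext => z; rewrite /q; ring.
  apply: (@le_trans _ _ (E (fun z => (7 * L * t * l1norm b ^+ 3 * expR 2) * expR (4 * l1norm z)))).
    apply: (gexp_norm_le hE); first by apply: tameM => //; exact: tameB.
      by apply: tameZ; exact: tame_expR_l1norm.
    move=> z; rewrite normrM.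
    have eq := @expR_quadratic R (l1norm b) (l1norm z) (dotp b z) (dotp b b).
    have eb : `|e z - q z| <= 7 * l1norm b ^+ 3 * expR (2 * (l1norm z + 1)).
      apply: eq; rewrite ?l1norm_ge0//; first exact: dotp_le.
      by rewrite dotp_ge0 dotp_self_le.
    have ll : l1norm z <= expR (2 * l1norm z).
      apply: (@le_trans _ _ (2 * l1norm z)).
        by rewrite ler_peMl ?l1norm_ge0// ler1n.
      by apply: le_trans (expR_ge1Dx _); rewrite lerDr.
    apply: (@le_trans _ _ ((L * t * expR (2 * l1norm z)) * (7 * l1norm b ^+ 3 * expR (2 * (l1norm z + 1))))).
      apply: ler_pM => //; apply: (le_trans (gl z)); rewrite ler_wpM2l//.
      by rewrite mulr_ge0// ltW.
    have -> : expR (4 * l1norm z) = expR (2 * l1norm z) * expR (2 * l1norm z).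
      by rewrite -expRD; congr expR; ring.
    rewrite mulrDr mulr1 expRD.
    by rewrite le_eqVlt; apply/orP; left; apply/eqP; ring.
  rewrite (gexpZ hE); last exact: tame_expR_l1norm.
  rewrite -/(K 4) ler_pdivlMr ?exprn_gt0//.
  have -> : 7 * L * t * l1norm b ^+ 3 * expR 2 * K 4 * t ^+ 2 =
     7 * L * expR 2 * K 4 * l1norm a ^+ 3 by rewrite l1a; ring.
  apply: (@le_trans _ _ (7 * L * expR 2 * K 4 * (6 * expR (l1norm a)))).
    by rewrite ler_wpM2l// !mulr_ge0 ?expR_ge0.
  rewrite /smooth_const.
  have : 0 <= 6 * (1 + 2 * K 1 + 4 * K 1) * L * expR (l1norm a).
    by rewrite !mulr_ge0 ?expR_ge0// !addr_ge0 ?mulr_ge0.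
  lra.
(* Here |a| > t, and L |a| as well as L |a|^2 / t are below L |a|^3 / t^2, so that
   the three terms can be bounded separately. *)
- have lat : t <= l1norm a by rewrite l1a ler_peMr// ltW.
  have A1 : `|E (fun z => h (y + a + t *: z)) - E (fun z => h (y + t *: z))| <= L * l1norm a.
    rewrite -(gexpB hE)// -[leRHS](gexp_cst hE); apply: (gexp_norm_le hE).
    + exact: tameB.
    + exact: tame_cst.
    + move=> z; apply: (le_trans (hL _ _)).
      by rewrite opprD addrACA subrr addr0 addrAC subrr add0r.
  have A2 : `|E (fun z => g z * dotp b z)| <= 2 * L * l1norm a * K 1.
    rewrite /expl1 -(gexpZ hE); last exact: tame_expR_l1norm.
    apply: (gexp_norm_le hE) => //; first by apply: tameZ; exact: tame_expR_l1norm.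
    move=> z; rewrite normrM.
    apply: (@le_trans _ _ ((L * t * l1norm z) * (l1norm b * l1norm z))).
      by apply: ler_pM => //; exact: dotp_le.
    rewrite l1a mul1r (_ : L * t * l1norm z * (l1norm b * l1norm z) = (L * (t * l1norm b)) * l1norm z ^+ 2); last by ring.
    rewrite (_ : 2 * L * (t * l1norm b) * expR (l1norm z) = (L * (t * l1norm b)) * (2 * expR (l1norm z))); last by ring.
    rewrite ler_wpM2l ?mulr_ge0// ?(ltW t0)//.
    exact: (expR_ge_pow 2 (l1norm_ge0 z)).
  have A3 : `|E (fun z => g z * (dotp b z ^+ 2 - dotp b b))| <= 8 * L * l1norm a * l1norm b * K 1.
    rewrite /expl1 -(gexpZ hE); last exact: tame_expR_l1norm.
    apply: (gexp_norm_le hE) => //; first by apply: tameZ; exact: tame_expR_l1norm.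
    move=> z; rewrite normrM.
    have z0 := l1norm_ge0 z.
    apply: (@le_trans _ _ ((L * t * l1norm z) * (l1norm b ^+ 2 * (l1norm z ^+ 2 + 1)))).
      apply: ler_pM => //; apply: (le_trans (ler_normB _ _)).
      rewrite mulrDr mulr1 lerD//; last first.
        by rewrite ger0_norm ?dotp_ge0// dotp_self_le.
      rewrite normrX -exprMn lerXn2r ?nnegrE ?mulr_ge0//; exact: dotp_le.
    rewrite l1a mul1r (_ : L * t * l1norm z * (l1norm b ^+ 2 * (l1norm z ^+ 2 + 1)) =
      (L * (t * l1norm b) * l1norm b) * (l1norm z ^+ 3 + l1norm z)); last by ring.
    rewrite (_ : 8 * L * (t * l1norm b) * l1norm b * expR (l1norm z) =
      (L * (t * l1norm b) * l1norm b) * (8 * expR (l1norm z))); last by ring.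
    rewrite ler_wpM2l ?mulr_ge0// ?(ltW t0)//.
    have := expR_ge_pow 3 z0; have := expR_ge_pow 1 z0.
    rewrite expr1 (_ : 3`!%:R = 6)// (_ : 1`!%:R = 1)//.
    have := expR_ge0 (l1norm z); lra.
  have bb : l1norm a * l1norm b <= l1norm a ^+ 3 / t ^+ 2.
    rewrite l1a ler_pdivlMr ?exprn_gt0//.
    have -> : (t * l1norm b) ^+ 3 = (t * l1norm b * l1norm b * t ^+ 2) * l1norm b by ring.
    by apply: ler_peMr; rewrite ?(ltW b1)// !mulr_ge0 ?sqr_ge0// ltW.
  have ba : l1norm a <= l1norm a ^+ 3 / t ^+ 2.
    apply: le_trans bb; by rewrite ler_peMr ?l1norm_ge0// ltW.
  have la0 := l1norm_ge0 a.
  set f := E (fun z => h (y + a + t *: z)) in A1 *.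
  set c0 := E (fun z => h (y + t *: z)) in A1 *.
  set x2 := E (fun z => g z * dotp b z) in A2 *.
  set x3 := E (fun z => g z * (dotp b z ^+ 2 - dotp b b)) in A3 *.
  have -> : f - (c0 + x2 + x3 / 2) = (f - c0) - x2 - x3 / 2 by ring.
  apply: (@le_trans _ _ ((1 + 2 * K 1 + 4 * K 1) * L * (l1norm a ^+ 3 / t ^+ 2))).
    apply: (le_trans (ler_normB _ _)); rewrite normrM [`|2^-1|]ger0_norm//.
    apply: (@le_trans _ _ (L * l1norm a + 2 * L * l1norm a * K 1 + 8 * L * l1norm a * l1norm b * K 1 / 2)).
      apply: lerD; last by rewrite ler_wpM2r.
      by apply: (le_trans (ler_normB _ _)); exact: lerD.
    have m1 : L * l1norm a <= L * (l1norm a ^+ 3 / t ^+ 2) by rewrite ler_wpM2l.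
    have m2 : (2 * L * K 1) * l1norm a <= (2 * L * K 1) * (l1norm a ^+ 3 / t ^+ 2).
      by rewrite ler_wpM2l// !mulr_ge0.
    have m3 : (4 * L * K 1) * (l1norm a * l1norm b) <= (4 * L * K 1) * (l1norm a ^+ 3 / t ^+ 2).
      by rewrite ler_wpM2l// !mulr_ge0.
    set r := l1norm a ^+ 3 / t ^+ 2 in m1 m2 m3 *; lra.
  rewrite mulrA ler_pM2r ?invr_gt0 ?exprn_gt0//.
  apply: (@le_trans _ _ ((1 + 2 * K 1 + 4 * K 1) * L * (6 * expR (l1norm a)))).
    by rewrite ler_wpM2l// mulr_ge0// !addr_ge0 ?mulr_ge0.
  rewrite /smooth_const.
  have : 0 <= 42 * expR 2 * K 4 * L * expR (l1norm a) by rewrite !mulr_ge0 ?expR_ge0.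
  lra.
Qed.

End smoothing.

(** * The Poisson equation of a finite irreducible chain *)
Section finite_chain.
Context (R : realType) (S : finType) (p : S -> S -> R) (pi : S -> R).
Hypotheses (sp : stochastic p) (ip : irreducible p) (invp : invariant_distribution p pi).

Lemma nstep_ge0 n x y : 0 <= nstep p n x y.
Proof.
elim: n x => [|n ih] x /=; first exact: ler0n.
by apply: sumr_ge0 => z _; rewrite mulr_ge0//; exact: sp.1.
Qed.

Lemma nstep_sum1 n x : \sum_y nstep p n x y = 1.
Proof.
elim: n x => [|n ih] x /=.
  by rewrite (bigD1 x)//= eqxx big1 ?addr0// => y yx; rewrite eq_sym (negbTE yx).
rewrite exchange_big/= -[RHS](sp.2 x); apply: eq_bigr => z _.
by rewrite -mulr_sumr ih mulr1.
Qed.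

Lemma nstep_harmonic (f : S -> R) : (forall x, f x = \sum_y p x y * f y) ->
  forall n x, f x = \sum_y nstep p n x y * f y.
Proof.
move=> hf; elim=> [|n ih] x /=.
  rewrite (bigD1 x)//= eqxx mul1r big1 ?addr0// => y yx.
  by rewrite eq_sym (negbTE yx) mul0r.
rewrite [LHS]hf.
transitivity (\sum_z \sum_y p x z * (nstep p n z y * f y)).
  by apply: eq_bigr => z _; rewrite -mulr_sumr -ih.
rewrite exchange_big/=; apply: eq_bigr => y _; rewrite mulr_suml.
by apply: eq_bigr => z _; rewrite mulrA.
Qed.

Lemma nstep_invariant n y : \sum_x pi x * nstep p n x y = pi y.
Proof.
have [_ _ ipi] := invp.
elim: n y => [|n ih] y /=.
  rewrite (bigD1 y)//= eqxx mulr1 big1 ?addr0// => x xy.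
  by rewrite (negbTE xy) mulr0.
rewrite -[RHS]ih; under eq_bigr do rewrite mulr_sumr.
rewrite exchange_big/=; apply: eq_bigr => z _.
by under eq_bigr do rewrite mulrA; rewrite -mulr_suml ipi.
Qed.

Lemma invariant_gt0 y : 0 < pi y.
Proof.
have [pi0 pi1 _] := invp.
have [x px] : exists x, 0 < pi x.
  apply: contrapT => h; have : \sum_x pi x = 0.
    apply: big1 => x _; apply/eqP; rewrite eq_le pi0 andbT leNgt.
    by apply/negP => px; apply: h; exists x.
  by rewrite pi1 => /eqP; rewrite oner_eq0.
have [n pn] := ip x y.
rewrite -(nstep_invariant n y) (bigD1 x)//= ltr_pwDl ?mulr_gt0//.
by apply: sumr_ge0 => z _; rewrite mulr_ge0// nstep_ge0.
Qed.

(** Maximum principle: the maximum is an average of the values at the states reached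
    in n steps, so each of these values is maximal. *)
Lemma harmonic_const (f : S -> R) : (forall x, f x = \sum_y p x y * f y) ->
  forall x y, f x = f y.
Proof.
move=> hf x y.
have [x0 _ hmax] := @Order.TotalTheory.arg_maxP _ _ _ x predT f erefl.
suff h z : f z = f x0 by rewrite !h.
have [n pn] := ip x0 z.
have : \sum_y nstep p n x0 y * (f x0 - f y) = 0.
  under eq_bigr do rewrite mulrBr.
  by rewrite sumrB -mulr_suml nstep_sum1 mul1r -nstep_harmonic// subrr.
move=> /psumr_eq0P h0.
have /eqP : nstep p n x0 z * (f x0 - f z) = 0.
  by apply: h0 => // w _; rewrite mulr_ge0 ?nstep_ge0// subr_ge0; exact: hmax.
by rewrite mulf_eq0 gt_eqF//= subr_eq0 => /eqP.
Qed.

(** Since only constants are harmonic, I - P has corank 1. Its image lies in the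
    hyperplane of functions with pi-mean 0, which it therefore fills. Unlike the
    series of the P^n g, this also covers periodic chains. *)
Lemma poisson_equation (g : S -> R) : \sum_x pi x * g x = 0 ->
  exists W : S -> R, forall x, W x - \sum_y p x y * W y = g x.
Proof.
move=> pg; have [pi0 pi1 ipi] := invp.
pose n := #|S|; pose s (i : 'I_n) : S := enum_val i.
(* Functions are row vectors, on which I - P acts by multiplication on the right. *)
pose A : 'M[R]_n := \matrix_(i, j) ((i == j)%:R - p (s j) (s i)).
have sumE (F : S -> R) : \sum_x F x = \sum_(i < n) F (s i).
  by rewrite (reindex s)//; exists enum_rank => ? _; [exact: enum_valK|exact: enum_rankK].
have mulA (w : 'rV[R]_n) j :
    (w *m A) 0 j = w 0 j - \sum_i p (s j) (s i) * w 0 i.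
  rewrite mxE; under eq_bigr do rewrite mxE mulrBr.
  rewrite sumrB (bigD1 j)//= eqxx mulr1 big1 ?addr0; last first.
    by move=> i ij; rewrite (negbTE ij) mulr0.
  by congr (_ - _); apply: eq_bigr => i _; rewrite mulrC.
pose piv : 'cV[R]_n := \col_j pi (s j).
have Apiv : A *m piv = 0.
  apply/matrixP => i j; rewrite !mxE.
  under eq_bigr do rewrite !mxE mulrBl.
  rewrite sumrB (bigD1 i)//= eqxx mul1r big1 ?addr0; last first.
    by move=> k ki; rewrite eq_sym (negbTE ki) mul0r.
  under eq_bigr do rewrite mulrC.
  by rewrite -(sumE (fun x => pi x * p x (s i))) ipi subrr.
have kA : (kermx A <= (const_mx 1 : 'rV[R]_n))%MS.
  apply/row_subP => i; set u := row i (kermx A).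
  have uA : u *m A = 0 by rewrite /u -row_mul mulmx_ker row0.
  pose f x := u 0 (enum_rank x).
  have fs k : f (s k) = u 0 k by rewrite /f /s enum_valK.
  have hf x : f x = \sum_y p x y * f y.
    have := mulA u (enum_rank x); rewrite uA mxE => /esym/eqP.
    rewrite subr_eq0 => /eqP; rewrite -/(f x) => ->.
    rewrite (sumE (fun y => p x y * f y)); apply: eq_bigr => k _.
    by rewrite /s enum_rankK -/(s k) fs.
  have [x0 _|S0] := pickP (fun _ : S => true).
    apply/submxP; exists (f x0)%:M; apply/rowP => k.
    transitivity (f (s k)); first by rewrite fs.
    by rewrite mul_scalar_mx !mxE mulr1; exact: harmonic_const.
  by rewrite (_ : u = 0) ?sub0mx//; apply/rowP => k; have := S0 (s k).
have r1 : (\rank (kermx A) <= 1)%N.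
  by apply: leq_trans (mxrankS kA) _; exact: rank_leq_row.
have piv0 : piv != 0.
  apply/eqP => /colP h; move: pi1; rewrite sumE big1 => [|i _].
    by move=> /eqP; rewrite eq_sym oner_eq0.
  by have := h i; rewrite !mxE.
have rpiv : (0 < \rank piv)%N by rewrite lt0n mxrank_eq0.
have ker_sub : (kermx piv <= A)%MS.
  have Asub : (A <= kermx piv)%MS by apply/sub_kermxP.
  rewrite -(geq_leqif (mxrank_leqif_sup Asub)) mxrank_ker.
  apply: leq_trans (leq_sub2l n rpiv) _.
  by move: r1; rewrite mxrank_ker !leq_subLR addnC.
pose gv : 'rV[R]_n := \row_j g (s j).
have /submxP[w gw] : (gv <= A)%MS.
  apply: submx_trans ker_sub; apply/sub_kermxP.
  apply/matrixP => i j; rewrite !mxE.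
  under eq_bigr do rewrite !mxE mulrC.
  by rewrite -(sumE (fun x => pi x * g x)).
exists (fun x => w 0 (enum_rank x)) => x.
have := mulA w (enum_rank x); rewrite -gw mxE /s enum_rankK => ->.
congr (_ - _); rewrite sumE; apply: eq_bigr => k _.
by rewrite enum_valK.
Qed.

End finite_chain.

(** * Second differences and correctors *)
Section corrector.
Context (R : realType) (d : nat).
Implicit Types (f : 'cV[R]_d -> R) (W : 'I_d -> 'I_d -> R) (u a : 'cV[R]_d).

Definition diff2 i j f u : R :=
  f (u + delta_mx i 0 + delta_mx j 0) - f (u + delta_mx i 0)
  - f (u + delta_mx j 0) + f u.

(** The second differences stand for the Hessian of f. Unlike it they are
    combinations of translates of f, hence commute with Gaussian averaging and
    are bounded for Lipschitz f. *)
Definition corrected W f u : R := f u + \sum_i \sum_j W i j * diff2 i j f u.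

Definition quad (c : R) (D : 'I_d -> R) (H : 'I_d -> 'I_d -> R) a : R :=
  c + \sum_i D i * a i 0 + \sum_i \sum_j H i j * (a i 0 * a j 0).

Lemma l1norm_delta i : l1norm (delta_mx i 0 : 'cV[R]_d) = 1.
Proof.
rewrite /l1norm (bigD1 i)//= mxE !eqxx normr1 big1 ?addr0// => j ji.
by rewrite mxE (negbTE ji) normr0.
Qed.

Lemma diff2_quad c D H i j a : (forall k l, H k l = H l k) ->
  diff2 i j (quad c D H) a = 2 * H i j.
Proof.
move=> Hs.
pose B (x y : 'cV[R]_d) := \sum_k \sum_l H k l * (x k 0 * y l 0).
pose l (x : 'cV[R]_d) := \sum_k D k * x k 0.
have lD x y : l (x + y) = l x + l y.
  by rewrite /l -big_split/=; apply: eq_bigr => k _; rewrite mxE mulrDr.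
have BDl x y z : B (x + y) z = B x z + B y z.
  rewrite /B -big_split/=; apply: eq_bigr => k _; rewrite -big_split/=.
  by apply: eq_bigr => m _; rewrite mxE; ring.
have BDr x y z : B z (x + y) = B z x + B z y.
  rewrite /B -big_split/=; apply: eq_bigr => k _; rewrite -big_split/=.
  by apply: eq_bigr => m _; rewrite mxE; ring.
have Bsym x y : B x y = B y x.
  rewrite /B exchange_big/=; apply: eq_bigr => k _; apply: eq_bigr => m _.
  by rewrite Hs (mulrC (x m 0)).
have Bd : B (delta_mx i 0) (delta_mx j 0) = H i j.
  rewrite /B (bigD1 i)//= [X in _ + X]big1 ?addr0 => [|k ki]; last first.
    by apply: big1 => m _; rewrite mxE (negbTE ki) mul0r mulr0.
  rewrite (bigD1 j)//= [X in _ + X]big1 ?addr0 => [|m mj]; last first.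
    by rewrite [delta_mx j 0 m 0]mxE (negbTE mj) !mulr0.
  by rewrite !mxE !eqxx !mulr1.
have qE x : quad c D H x = c + l x + B x x by [].
rewrite /diff2 !qE !lD !BDl !BDr -Bd (Bsym (delta_mx j 0) (delta_mx i 0)).
rewrite (Bsym (delta_mx j 0) a) (Bsym (delta_mx i 0) a); ring.
Qed.

Lemma diff2_lipschitz L f i j u : lipschitz_l1 L f -> `|diff2 i j f u| <= 2 * L.
Proof.
move=> hf; rewrite /diff2.
have h1 := hf (u + delta_mx i 0 + delta_mx j 0) (u + delta_mx i 0).
have h2 := hf (u + delta_mx j 0) u.
rewrite [X in l1norm X]addrAC subrr add0r l1norm_delta mulr1 in h1.
rewrite [X in l1norm X]addrAC subrr add0r l1norm_delta mulr1 in h2.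
move: h1 h2; rewrite !ler_norml => /andP[? ?] /andP[? ?]; apply/andP; split; lra.
Qed.

Lemma corrected_shift W f u a :
  corrected W f (u + a) = corrected W (fun b => f (u + b)) a.
Proof.
congr (_ + _); apply: eq_bigr => i _; apply: eq_bigr => j _.
by rewrite /diff2 !addrA.
Qed.

Definition wnorm W : R := \sum_i \sum_j `|W i j|.

Lemma wnorm_ge0 W : 0 <= wnorm W.
Proof. by apply: sumr_ge0 => i _; apply: sumr_ge0. Qed.

Lemma sum_wnorm_le W (x : 'I_d -> 'I_d -> R) (b : R) : (forall i j, `|x i j| <= b) ->
  `|\sum_i \sum_j W i j * x i j| <= wnorm W * b.
Proof.
move=> hx; apply: (le_trans (ler_norm_sum _ _ _)).
rewrite /wnorm mulr_suml; apply: ler_sum => i _.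
apply: (le_trans (ler_norm_sum _ _ _)); rewrite mulr_suml; apply: ler_sum => j _.
by rewrite normrM ler_wpM2l.
Qed.

Lemma corrected_lipschitz W L f u : lipschitz_l1 L f ->
  `|corrected W f u - f u| <= wnorm W * (2 * L).
Proof.
move=> hf; rewrite /corrected addrAC subrr add0r.
by apply: sum_wnorm_le => i j; exact: diff2_lipschitz.
Qed.

(** Second differences of the quadratic polynomial are the constants 2 H i j, and
    each second difference of the remainder combines four of its values. *)
Lemma corrected_quad W f c D H (A : R) a : 0 <= A ->
  (forall k l, H k l = H l k) ->
  (forall b, `|f b - quad c D H b| <= A * expR (l1norm b)) ->
  `|corrected W f a - (quad c D H a + 2 * \sum_i \sum_j W i j * H i j)| <=
    A * (1 + 4 * expR 2 * wnorm W) * expR (l1norm a).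
Proof.
move=> A0 Hs hf; set q := quad c D H.
have hd b c' : l1norm c' <= 2 -> `|f (b + c') - q (b + c')| <= A * expR 2 * expR (l1norm b).
  move=> c2; apply: (le_trans (hf _)); rewrite -mulrA ler_wpM2l// -expRD ler_expR.
  by rewrite [leRHS]addrC; apply: (le_trans (ler_l1normD _ _)); rewrite lerD2l.
have dd i j : `|diff2 i j f a - 2 * H i j| <= 4 * (A * expR 2 * expR (l1norm a)).
  rewrite -(@diff2_quad c D H i j a Hs) /diff2.
  have l11 k : l1norm (delta_mx k 0 : 'cV[R]_d) <= 2 by rewrite l1norm_delta ler1n.
  have h1 := hd a _ (l11 i); have h2 := hd a _ (l11 j).
  have h3 : `|f (a + delta_mx i 0 + delta_mx j 0) - q (a + delta_mx i 0 + delta_mx j 0)| <=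
      A * expR 2 * expR (l1norm a).
    rewrite -addrA; apply: hd; apply: (le_trans (ler_l1normD _ _)).
    by rewrite !l1norm_delta.
  have h4 := hd a 0; rewrite l1norm0 addr0 in h4; have {}h4 := h4 (ler0n R 2).
  rewrite -/q; move: h1 h2 h3 h4; rewrite !ler_norml.
  move=> /andP[? ?] /andP[? ?] /andP[? ?] /andP[? ?].
  by apply/andP; split; lra.
have -> : corrected W f a - (q a + 2 * \sum_i \sum_j W i j * H i j) =
   (f a - q a) + \sum_i \sum_j W i j * (diff2 i j f a - 2 * H i j).
  have -> : \sum_i \sum_j W i j * (diff2 i j f a - 2 * H i j) =
     \sum_i \sum_j W i j * diff2 i j f a - 2 * \sum_i \sum_j W i j * H i j.
    rewrite mulr_sumr -sumrB; apply: eq_bigr => i _; rewrite mulr_sumr -sumrB.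
    by apply: eq_bigr => j _; ring.
  by rewrite /corrected; ring.
apply: (le_trans (ler_normD _ _)).
have s1 := sum_wnorm_le W dd.
have -> : A * (1 + 4 * expR 2 * wnorm W) * expR (l1norm a) =
   A * expR (l1norm a) + wnorm W * (4 * (A * expR 2 * expR (l1norm a))) by ring.
exact: lerD.
Qed.

Lemma gexp_quad (E : ('cV[R]_d -> R) -> R) c D H : gaussian_expectation E ->
  E (quad c D H) = c + \sum_i H i i.
Proof.
move=> hE; have tc i := @tame_coord R d i.
have tcc i j : tame (fun a : 'cV[R]_d => a i 0 * a j 0) by exact: tameM.
rewrite /quad (gexpD hE); last 2 first.
- by apply: tameD; [exact: tame_cst|apply: tame_sum => i _; exact: tameZ].
- by apply: tame_sum => i _; apply: tame_sum => j _; exact: tameZ.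
rewrite (gexpD hE) ?(gexp_cst hE); [|exact: tame_cst|by apply: tame_sum => i _; exact: tameZ].
rewrite (gexp_sum hE); last by move=> i; exact: tameZ.
rewrite big1 ?addr0 => [|i _]; last by rewrite (gexpZ hE)// (gexp_coord hE) mulr0.
congr (_ + _); rewrite (gexp_sum hE); last by move=> i; apply: tame_sum => j _; exact: tameZ.
apply: eq_bigr => i _; rewrite (gexp_sum hE); last by move=> j; exact: tameZ.
rewrite (bigD1 i)//= big1 ?addr0 => [|j ji]; last first.
  by rewrite (gexpZ hE)// (gexp_coord2 hE) eq_sym (negbTE ji) mulr0.
by rewrite (gexpZ hE)// (gexp_coord2 hE) eqxx mulr1.
Qed.

End corrector.

(** * Lindeberg replacement along the chain *)
Section lindeberg.
Context (R : realType) (d : nat) (E : ('cV[R]_d -> R) -> R).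
Hypothesis hE : gaussian_expectation E.
Context (S : finType) (p : S -> S -> R) (pi : S -> R).
Hypotheses (sp : stochastic p) (ip : irreducible p) (invp : invariant_distribution p pi).
Context (V : S -> 'cV[R]_d).

Let g x : 'cV[R]_d := V x - transition_op p V x.
Let xi x y : 'cV[R]_d := V y - transition_op p V x.
Let v x i j : R := \sum_y p x y * (xi x y i 0 * xi x y j 0).

Hypothesis cov1 : forall i j, \sum_x pi x * v x i j = (i == j)%:R.

(** The transition operator of the pair (accumulated sum, state): the summand is read
    off the state before the jump. *)
Definition chain_op (a : S -> 'cV[R]_d) (F : 'cV[R]_d -> S -> R) (y : 'cV[R]_d) (x : S) : R :=
  \sum_x' p x x' * F (y + a x) x'.

Lemma chain_op_close (a : S -> 'cV[R]_d) (F G : 'cV[R]_d -> S -> R) (b : R) :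
  (forall y x, `|F y x - G y x| <= b) ->
  forall y x, `|chain_op a F y x - chain_op a G y x| <= b.
Proof.
move=> h y x; rewrite /chain_op -sumrB; apply: (le_trans (ler_norm_sum _ _ _)).
rewrite -[leRHS]mul1r -(sp.2 x) mulr_suml; apply: ler_sum => x' _.
by rewrite -mulrBr normrM ger0_norm ?(sp.1)// ler_wpM2l ?(sp.1).
Qed.

Lemma iter_chain_op_close (a : S -> 'cV[R]_d) n (F G : 'cV[R]_d -> S -> R) (b : R) :
  (forall y x, `|F y x - G y x| <= b) ->
  forall y x, `|iter n (chain_op a) F y x - iter n (chain_op a) G y x| <= b.
Proof. by move=> h; elim: n => [|n ih] //=; exact: chain_op_close. Qed.

Lemma xi_mean0 x i : \sum_y p x y * xi x y i 0 = 0.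
Proof.
under eq_bigr do rewrite /xi !mxE mulrBr.
rewrite sumrB -mulr_suml sp.2 mul1r; apply/eqP; rewrite subr_eq0; apply/eqP.
by rewrite /transition_op summxE; apply: eq_bigr => y _; rewrite mxE.
Qed.

(** The variance is an integer because the sums are not normalized: every step of
    the chain is traded for one unit of Gaussian variance. *)
Let smooth h k (u : 'cV[R]_d) := E (fun z => h (u + Num.sqrt k%:R *: z)).

Lemma smooth_lipschitz L h k : 0 <= L -> lipschitz_l1 L h -> lipschitz_l1 L (smooth h k).
Proof.
move=> L0 hL u u'; rewrite /smooth -(gexpB hE); do ?[exact: (tame_smooth _ _ L0 hL)].
rewrite -[leRHS](gexp_cst hE); apply: (gexp_norm_le hE).
- by apply: tameB; exact: (tame_smooth _ _ L0 hL).
- exact: tame_cst.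
- by move=> z; apply: (le_trans (hL _ _)); rewrite opprD addrACA subrr addr0.
Qed.

(** The variance k + 1 splits into 1 and k. As the semigroup formula has its scaled
    vector outside, it is applied to h with its argument multiplied by sqrt k. *)
Lemma smooth_succ L h k u : 0 <= L -> lipschitz_l1 L h -> (0 < k)%N ->
  smooth h k.+1 u = E (fun z => smooth h k (u + z)).
Proof.
move=> L0 hL k0; set s : R := Num.sqrt k%:R.
have s0 : 0 < s by rewrite sqrtr_gt0 ltr0n.
have hL' := lipschitz_l1_affine s u L0 hL.
have sn0 : s != 0 by rewrite gt_eqF.
have Ls : 0 <= L * `|s| by rewrite mulr_ge0.
have si0 : 0 < s^-1 by rewrite invr_gt0.
have := gexp_semigroup hE Ls hL' si0 => e.
transitivity (E (fun z => h (u + s *: (Num.sqrt (1 + s^-1 ^+ 2) *: z)))).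
  rewrite /smooth; congr E; apply/funext => z; rewrite scalerA -sqrtrM ?ler0n//.
  rewrite exprVn sqr_sqrtr ?ler0n// mulrDr mulr1 divff ?pnatr_eq0 -?lt0n//.
  by rewrite -natr1.
rewrite -e; congr E; apply/funext => z; rewrite /smooth; congr E; apply/funext => z'.
by rewrite scalerDr scalerA divff// scale1r addrA.
Qed.

(** Put u = y + V x. A step of the chain moves u by an increment xi of conditional
    mean 0 and covariance v x, whereas one more unit of smoothing moves it by a
    Gaussian vector of covariance I. On the quadratic expansion around u, with
    Hessian 2 H, the two averages differ by H : (v x - I). This term is not small,
    but v - I has pi-mean 0: choosing W with W - P W = (v - I) / 2, the corrector
    contributes 2 H : (P W - W), which cancels it. Only the remainders of the
    expansion are left, and they are of order L / k. *)
Lemma lindeberg_step : exists (W : S -> 'I_d -> 'I_d -> R) (C : R), 0 <= C /\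
  forall L h k, 0 <= L -> lipschitz_l1 L h -> (0 < k)%N -> forall y x,
  `|chain_op g (fun y x => corrected (W x) (smooth h k) (y + V x)) y x -
    corrected (W x) (smooth h k.+1) (y + V x)| <= C * L / k%:R.
Proof.
have Wex i j : exists W : S -> R, forall x,
    W x - \sum_y p x y * W y = (v x i j - (i == j)%:R) / 2.
  apply: (poisson_equation sp ip invp).
  under eq_bigr do rewrite mulrA mulrBr.
  rewrite -mulr_suml sumrB -mulr_suml cov1.
  by have [_ -> _] := invp; rewrite mul1r subrr mul0r.
pose W x i j := proj1_sig (cid (Wex i j)) x.
have WP x i j : W x i j - \sum_y p x y * W y i j = (v x i j - (i == j)%:R) / 2.
  exact: (proj2_sig (cid (Wex i j)) x).
pose w := \sum_x wnorm (W x).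
have wle x : wnorm (W x) <= w.
  by rewrite /w (bigD1 x)//= lerDl; apply: sumr_ge0 => ? _; exact: wnorm_ge0.
pose m := \sum_x \sum_y l1norm (xi x y).
have mle x y : l1norm (xi x y) <= m.
  rewrite /m (bigD1 x)//= (bigD1 y)//= -addrA lerDl addr_ge0//.
    by apply: sumr_ge0 => ? _; exact: l1norm_ge0.
  by apply: sumr_ge0 => ? _; apply: sumr_ge0 => ? _; exact: l1norm_ge0.
have w0 : 0 <= w by apply: sumr_ge0 => ? _; exact: wnorm_ge0.
have K1 := expl1_ge0 hE (ler0n R 1).
have sc0 := smooth_const_ge0 hE.
pose C := smooth_const E * (1 + 4 * expR 2 * w) * (expR m + expl1 E 1).
exists W, C; split.
  by rewrite /C !mulr_ge0// addr_ge0// ?mulr_ge0 ?expR_ge0.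
move=> L h k L0 hL k0 y x.
have kR : 0 < k%:R :> R by rewrite ltr0n.
have t1 : 1 <= Num.sqrt k%:R :> R by rewrite -[X in X <= _]sqrtr1 ler_sqrt ?ler1n.
set u := y + V x.
have [c [D [H [Hs Hq]]]] := smooth_quadratic hE u L0 hL t1.
pose A := smooth_const E * L / k%:R.
have A0 : 0 <= A by rewrite /A !mulr_ge0// invr_ge0 ler0n.
pose f a := smooth h k (u + a).
have fq a : `|f a - quad c D H a| <= A * expR (l1norm a).
  apply: (le_trans (Hq a)); rewrite sqr_sqrtr ?ler0n// /A.
  by rewrite le_eqVlt; apply/orP; left; apply/eqP; ring.
have fL : lipschitz_l1 L f.
  move=> a b; apply: (le_trans (smooth_lipschitz k L0 hL _ _)).
  by rewrite opprD addrACA subrr add0r.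
have tf b : tame (fun z => f (b + z)).
  apply: (@tame_lipschitz _ _ L) => // a a'; apply: (le_trans (fL _ _)).
  by rewrite opprD addrACA subrr add0r.
have tf0 : tame f by exact: (tame_lipschitz L0 fL).
have tdiff i j : tame (fun z => diff2 i j f z).
  apply: tameD => //; apply: tameB; last exact: tame_shift.
  apply: tameB; last exact: tame_shift.
  exact: (tame_shift _ (tame_shift _ tf0)).
have tcor : tame (corrected (W x) f).
  apply: tameD => //; apply: tame_sum => i _; apply: tame_sum => j _; exact: tameZ.
have tquad : tame (quad c D H).
  apply: tameD.
    by apply: tameD; [exact: tame_cst|apply: tame_sum => i _; apply: tameZ; exact: tame_coord].
  apply: tame_sum => i _; apply: tame_sum => j _; apply: tameZ.
  by apply: tameM; exact: tame_coord.
pose B := A * (1 + 4 * expR 2 * w).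
have B0 : 0 <= B by rewrite /B mulr_ge0// addr_ge0// ?mulr_ge0 ?expR_ge0.
have cq x' a : `|corrected (W x') f a - (quad c D H a + 2 * \sum_i \sum_j W x' i j * H i j)| <=
    B * expR (l1norm a).
  apply: (le_trans (corrected_quad (W x') a A0 Hs fq)).
  rewrite ler_wpM2r ?expR_ge0// ler_wpM2l// lerD2l ler_wpM2l ?mulr_ge0 ?expR_ge0//.
have right : corrected (W x) (smooth h k.+1) u = E (corrected (W x) f).
  have sE b : smooth h k.+1 (u + b) = E (fun z => f (z + b)).
    rewrite (smooth_succ _ L0 hL k0); congr E; apply/funext => z.
    by rewrite /f -addrA (addrC b).
  have s0 : smooth h k.+1 u = E f by rewrite (smooth_succ _ L0 hL k0).
  rewrite /corrected (gexpD hE)//; last first.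
    by apply: tame_sum => i _; apply: tame_sum => j _; exact: tameZ.
  rewrite s0 (gexp_sum hE); last by move=> i; apply: tame_sum => j _; exact: tameZ.
  congr (_ + _); apply: eq_bigr => i _; rewrite (gexp_sum hE); last by move=> j; exact: tameZ.
  apply: eq_bigr => j _; rewrite (gexpZ hE)//; congr (_ * _).
  have tij : tame (fun z => f (z + delta_mx i 0 + delta_mx j 0)).
    exact: (tame_shift _ (tame_shift _ tf0)).
  have ti l : tame (fun z => f (z + delta_mx l 0)) by exact: tame_shift.
  rewrite /diff2 (gexpD hE)//; last by apply: tameB => //; exact: tameB.
  rewrite (gexpB hE)//; last exact: tameB.
  rewrite (gexpB hE)// s0 -[u + _ + _]addrA !sE; congr (E _ - _ - _ + _).
  by apply/funext => z; rewrite addrA.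
have left : chain_op g (fun y x => corrected (W x) (smooth h k) (y + V x)) y x =
    \sum_x' p x x' * corrected (W x') f (xi x x').
  apply: eq_bigr => x' _; congr (_ * _).
  have -> : y + g x + V x' = u + xi x x'.
    by rewrite /g /xi /u -!addrA; congr (y + (_ + _)); rewrite addrC.
  exact: corrected_shift.
pose q0 : R := c + \sum_i \sum_j H i j * v x i j +
   2 * \sum_i \sum_j (\sum_x' p x x' * W x' i j) * H i j.
have lq : \sum_x' p x x' * (quad c D H (xi x x') + 2 * \sum_i \sum_j W x' i j * H i j) = q0.
  under eq_bigr do rewrite /quad !mulrDr.
  rewrite !big_split/= -mulr_suml sp.2 mul1r /q0.
  have -> : \sum_x' p x x' * (\sum_i D i * xi x x' i 0) = 0.
    under eq_bigr do rewrite mulr_sumr.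
    rewrite exchange_big/= big1// => i _.
    under eq_bigr do rewrite mulrCA.
    by rewrite -mulr_sumr xi_mean0 mulr0.
  rewrite addr0; congr (_ + _ + _).
    under eq_bigr do rewrite mulr_sumr.
    rewrite exchange_big/=; apply: eq_bigr => i _.
    under eq_bigr do rewrite mulr_sumr.
    rewrite exchange_big/=; apply: eq_bigr => j _.
    by rewrite mulr_sumr; apply: eq_bigr => x' _; rewrite mulrCA.
  under eq_bigr do rewrite mulrCA.
  rewrite -mulr_sumr; congr (2 * _).
  under eq_bigr do rewrite mulr_sumr.
  rewrite exchange_big/=; apply: eq_bigr => i _.
  under eq_bigr do rewrite mulr_sumr.
  rewrite exchange_big/=; apply: eq_bigr => j _.
  by rewrite mulr_suml; apply: eq_bigr => x' _; rewrite mulrA.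
have rq : E (fun a => quad c D H a + 2 * \sum_i \sum_j W x i j * H i j) = q0.
  rewrite (gexpD hE)//; last exact: tame_cst.
  rewrite (gexp_cst hE) (gexp_quad _ _ _ hE) /q0.
  have -> : \sum_i H i i = \sum_i \sum_j (i == j)%:R * H i j.
    apply: eq_bigr => i _; rewrite (bigD1 i)//= eqxx mul1r big1 ?addr0// => j ji.
    by rewrite eq_sym (negbTE ji) mul0r.
  rewrite -!addrA; congr (_ + _); rewrite !mulr_sumr -!big_split/=.
  apply: eq_bigr => i _; rewrite !mulr_sumr -!big_split/=; apply: eq_bigr => j _.
  have := WP x i j; set w1 := W x i j; set w2 := \sum_x' _ => e.
  have -> : w2 = w1 - (v x i j - (i == j)%:R) / 2 by rewrite -e; ring.
  by field.
rewrite left right.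
have hl : `|\sum_x' p x x' * corrected (W x') f (xi x x') - q0| <= B * expR m.
  rewrite -lq -sumrB; apply: (le_trans (ler_norm_sum _ _ _)).
  rewrite -[leRHS]mul1r -[X in _ <= X * _](sp.2 x) mulr_suml; apply: ler_sum => x' _.
  rewrite -mulrBr normrM ger0_norm ?(sp.1)// ler_wpM2l ?(sp.1)//.
  by apply: (le_trans (cq _ _)); rewrite ler_wpM2l// ler_expR.
have hr : `|E (corrected (W x) f) - q0| <= B * expl1 E 1.
  have tq2 : tame (fun a => quad c D H a + 2 * \sum_i \sum_j W x i j * H i j).
    by apply: tameD => //; exact: tame_cst.
  rewrite -rq -(gexpB hE)// /expl1 -(gexpZ hE); last exact: tame_expR_l1norm.
  apply: (gexp_norm_le hE); first exact: tameB.
    by apply: tameZ; exact: tame_expR_l1norm.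
  by move=> a; rewrite mul1r; exact: cq.
have -> : C * L / k%:R = B * expR m + B * expl1 E 1 by rewrite /C /B /A; ring.
set a1 := \sum_x' _ in hl *; set a2 := E _ in hr *.
have -> : a1 - a2 = (a1 - q0) - (a2 - q0) by ring.
by apply: (le_trans (ler_normB _ _)); exact: lerD.
Qed.

(** Telescoping: the chain takes the corrected smoothing of variance 1 to that of
    variance n + 1 at a total cost of order L times the sum of the 1 / k. Replacing
    h by its smoothing of variance 1, removing the last unit of variance, adding V
    and adding the correctors cost a bounded multiple of L each. *)
Lemma chain_op_gaussian : exists C : R, 0 <= C /\
  forall L h n, 0 <= L -> lipschitz_l1 L h -> (0 < n)%N -> forall x,
  `|iter n (chain_op g) (fun y _ => h y) 0 x - E (fun z => h (Num.sqrt n%:R *: z))| <=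
    C * L * (1 + \sum_(k < n) k.+1%:R^-1).
Proof.
have [W [C [C0 hC]]] := lindeberg_step.
pose w := \sum_x wnorm (W x).
have wle x : wnorm (W x) <= w.
  by rewrite /w (bigD1 x)//= lerDl; apply: sumr_ge0 => ? _; exact: wnorm_ge0.
have w0 : 0 <= w by apply: sumr_ge0 => ? _; exact: wnorm_ge0.
pose m := \sum_x l1norm (V x).
have mle x : l1norm (V x) <= m.
  by rewrite /m (bigD1 x)//= lerDl; apply: sumr_ge0 => ? _; exact: l1norm_ge0.
have m0 : 0 <= m by apply: sumr_ge0 => ? _; exact: l1norm_ge0.
pose e := E (@l1norm R d).
have e0 : 0 <= e by apply: (gexp_ge0 hE); [exact: tame_l1norm|exact: l1norm_ge0].
pose C' := C + 2 * (m + e + 2 * w).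
have C'0 : 0 <= C' by rewrite /C' !(addr_ge0, mulr_ge0).
exists C'; split=> // L h n L0 hL n0 x.
pose G k y x := corrected (W x) (smooth h k) (y + V x).
have Lmono a b : a <= b -> L * a <= L * b by move=> ab; rewrite ler_wpM2l.
have mean_close (f : 'cV[R]_d -> R) u u' : lipschitz_l1 L f ->
    `|E (fun z => f (u + z)) - f u'| <= L * (l1norm (u - u') + e).
  move=> fL; have tf : tame (fun z => f (u + z)).
    apply: (@tame_lipschitz _ _ L) => // a a'; apply: (le_trans (fL _ _)).
    by rewrite opprD addrACA subrr add0r.
  have tc := @tame_cst R d; have tl := @tame_l1norm R d.
  rewrite -(gexp_cst hE (f u')) -(gexpB hE)//.
  apply: (@le_trans _ _ (E (fun z => L * (l1norm (u - u') + l1norm z)))).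
    apply: (gexp_norm_le hE); first exact: tameB.
      by apply: tameZ; exact: tameD.
    move=> z; apply: (le_trans (fL _ _)); apply: Lmono.
    by rewrite addrAC; exact: ler_l1normD.
  by rewrite (gexpZ hE) ?(gexpD hE) ?(gexp_cst hE)//; exact: tameD.
have corr_close f u x' : lipschitz_l1 L f -> `|corrected (W x') f u - f u| <= L * (2 * w).
  move=> fL; apply: (le_trans (corrected_lipschitz (W x') u fL)).
  rewrite (_ : L * (2 * w) = w * (2 * L)); last by ring.
  by rewrite ler_wpM2r// mulr_ge0.
have sL k := smooth_lipschitz k L0 hL.
have first_step y x' : `|h y - G 1%N y x'| <= L * (m + e + 2 * w).
  have h1 := corr_close _ (y + V x') x' (sL 1%N).
  have h2 : `|smooth h 1 (y + V x') - h y| <= L * (m + e).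
    have -> : smooth h 1 (y + V x') = E (fun z => h (y + V x' + z)).
      by rewrite /smooth; congr E; apply/funext => z; rewrite sqrtr1 scale1r.
    apply: (le_trans (mean_close _ _ _ hL)); apply: Lmono; rewrite lerD2r.
    by rewrite addrAC subrr add0r.
  move: h1 h2; rewrite -/(G 1%N y x') !ler_norml => /andP[? ?] /andP[? ?].
  by apply/andP; split; lra.
have last_step x' : `|G n.+1 0 x' - E (fun z => h (Num.sqrt n%:R *: z))| <= L * (m + e + 2 * w).
  have h1 := corr_close _ (0 + V x') x' (sL n.+1).
  have h2 : `|smooth h n.+1 (0 + V x') - smooth h n 0| <= L * (m + e).
    rewrite (smooth_succ _ L0 hL n0).
    apply: (le_trans (mean_close _ _ _ (sL n))); apply: Lmono; rewrite lerD2r.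
    by rewrite add0r subr0.
  have -> : E (fun z => h (Num.sqrt n%:R *: z)) = smooth h n 0.
    by rewrite /smooth; congr E; apply/funext => z; rewrite add0r.
  move: h1 h2; rewrite -/(G n.+1 0 x') !ler_norml => /andP[? ?] /andP[? ?].
  by apply/andP; split; lra.
have steps N y x' : `|iter N (chain_op g) (G 1%N) y x' - G N.+1 y x'| <=
    C * L * \sum_(k < N) k.+1%:R^-1.
  elim: N y x' => [|N ih] y x'; first by rewrite big_ord0 mulr0 subrr normr0.
  rewrite big_ord_recr/= mulrDr.
  have -> : chain_op g (iter N (chain_op g) (G 1%N)) y x' - G N.+2 y x' =
     (chain_op g (iter N (chain_op g) (G 1%N)) y x' - chain_op g (G N.+1) y x') +
     (chain_op g (G N.+1) y x' - G N.+2 y x') by ring.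
  apply: (le_trans (ler_normD _ _)); apply: lerD; first exact: chain_op_close.
  exact: hC.
have h1 := iter_chain_op_close g n (F := fun y _ => h y) (G := G 1%N) first_step 0 x.
have h2 := steps n 0 x; have h3 := last_step x.
set H := \sum_(k < n) _ in h2 *.
have H0 : 0 <= H by apply: sumr_ge0 => k _; rewrite invr_ge0.
have -> : C' * L * (1 + H) = C * L * H + C * L + (2 * (L * (m + e + 2 * w))) * (1 + H).
  by rewrite /C'; ring.
have p1 : 0 <= C * L by rewrite mulr_ge0.
have p2 : 0 <= L * (m + e + 2 * w) by rewrite mulr_ge0// !addr_ge0// mulr_ge0.
have p3 : 0 <= L * (m + e + 2 * w) * H by rewrite mulr_ge0.
set b := L * (m + e + 2 * w) in h1 h3 p2 p3 *.
move: h1 h2 h3; rewrite !ler_norml => /andP[? ?] /andP[? ?] /andP[? ?].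
by apply/andP; split; lra.
Qed.

End lindeberg.

(** * Expectations of finite-valued variables *)
Section finite_valued.
Context (R : realType) disp (T : measurableType disp) (P : probability T R).
Context (I : finType) (Y : T -> I).
Hypothesis mY : forall i, measurable (Y @^-1` [set i]).

Lemma integral_finite_valued (phi : I -> R) (B : set T) : measurable B ->
  (\int[P]_(w in B) (phi (Y w))%:E =
   (\sum_i phi i * fine (P (Y @^-1` [set i] `&` B)))%:E)%E.
Proof.
move=> mB.
transitivity (\int[P]_(w in B) (\sum_(i <- enum I) (phi i * \1_(Y @^-1` [set i]) w)%:E))%E.
  apply: eq_integral => w _; rewrite sumEFin; congr (_%:E).
  rewrite big_enum/= (bigD1 (Y w))//= indicE mem_set// mulr1 big1 ?addr0// => i iY.
  by rewrite indicE memNset ?mulr0//= => e; rewrite -e eqxx in iY.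
have mi i : measurable_fun setT (fun w => (\1_(Y @^-1` [set i]) w : R)).
  exact: measurable_indic.
have ii i : P.-integrable B (fun w => (\1_(Y @^-1` [set i]) w : R)%:E).
  apply: (integrableS measurableT) => //; apply: integrable_indic => //.
rewrite integral_sum//; last first.
  by move=> i; under eq_fun do rewrite EFinM; exact: integrableZl.
rewrite big_enum/= -sumEFin; apply: eq_bigr => i _.
under eq_integral do rewrite EFinM.
rewrite integralZl// integral_indic// EFinM; congr (_ * _)%E.
by rewrite fineK// fin_num_measure//; exact: measurableI.
Qed.

Lemma expectation_finite_valued (phi : I -> R) :
  ('E_P[phi \o Y] = (\sum_i phi i * fine (P (Y @^-1` [set i])))%:E)%E.
Proof.
rewrite unlock integral_finite_valued//.
by congr (_%:E); apply: eq_bigr => i _; rewrite setIT.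
Qed.

End finite_valued.

(** * The law of the chain *)
Section chain_law.
Context (R : realType) (S : finType) (p : S -> S -> R) (pi : S -> R).
Context disp (T : measurableType disp) (P : probability T R) (X : nat -> T -> S).
Hypotheses (chainX : markov_chain P X p) (statX : stationary P X pi).

Let mX k x : measurable (X k @^-1` [set x]). Proof. by have [] := chainX. Qed.

Lemma measurable_history n x : measurable (history X n x).
Proof.
have -> : history X n x = \bigcap_(k in [set k | (k <= n)%N]) (X k @^-1` [set x k]).
  by apply/seteqP; split => w h k; exact: h.
by apply: bigcap_measurable => [|k _]; [exists 0%N|exact: mX].
Qed.

(** On null histories, where nothing is known of the conditional probability, both
    sides vanish. *)
Lemma history_succ n x :
  fine (P (X n.+1 @^-1` [set x n.+1] `&` history X n x)) =
  p (x n) (x n.+1) * fine (P (history X n x)).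
Proof.
have [_ _ mk] := chainX; have mh := measurable_history n x.
have [h0|h0] := eqVneq (P (history X n x)) 0%E.
  rewrite h0/= mulr0; suff -> : P (X n.+1 @^-1` [set x n.+1] `&` history X n x) = 0%E by [].
  by apply: (subset_measure0 _ _ _ h0) => //; exact: measurableI.
rewrite -(mk n x h0) /cond_prob divfK// fine_eq0 ?fin_num_measure//.
Qed.

Definition path_sum (V : zmodType) (a : S -> V) n (w : T) : V :=
  \sum_(0 <= k < n) a (X k w).

Let path n (w : T) : n.+1.-tuple S := [tuple X k w | k < n.+1].

Let nth_path x0 n w k : (k <= n)%N -> nth x0 (path n w) k = X k w.
Proof.
move=> kn; have kn' : (k < n.+1)%N by [].
by rewrite -[k]/(val (Ordinal kn')) -tnth_nth tnth_mktuple.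
Qed.

Let path_preim x0 n (t : n.+1.-tuple S) : path n @^-1` [set t] = history X n (nth x0 t).
Proof.
apply/seteqP; split => w /=.
  by move=> <- k kn; rewrite nth_path.
move=> h; apply/eq_from_tnth => i; rewrite tnth_mktuple (tnth_nth x0).
by apply: h; rewrite -ltnS.
Qed.

(** Conditioning on the whole path up to time n, which is a variable with finitely
    many values. *)
Lemma expectation_markov_step d (a : S -> 'cV[R]_d) (F : 'cV[R]_d -> S -> R) n :
  ('E_P[fun w => F (path_sum a n.+1 w) (X n.+1 w)] =
   'E_P[fun w => chain_op p a F (path_sum a n w) (X n w)])%E.
Proof.
have [x0 _|S0] := pickP (fun _ : S => true); last first.
  have E0 (f g : T -> R) : f = g by apply/funext => w; have := S0 (X 0%N w).
  by congr (expectation P _); exact: E0.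
have mh t : measurable (path n @^-1` [set t]).
  by rewrite (path_preim x0); exact: measurable_history.
pose Y w := (path n w, X n.+1 w).
have Ypre t z : Y @^-1` [set (t, z)] = X n.+1 @^-1` [set z] `&` path n @^-1` [set t].
  by apply/seteqP; split => w /=; [move=> [<- <-]|move=> [<- <-]].
have mY tz : measurable (Y @^-1` [set tz]).
  by case: tz => t z; rewrite Ypre; exact: measurableI.
pose A m (t : n.+1.-tuple S) := \sum_(0 <= k < m) a (nth x0 t k).
have Apath m w : (m <= n.+1)%N -> A m (path n w) = path_sum a m w.
  by move=> mn; apply: eq_big_nat => k /andP[_ km]; rewrite nth_path// -ltnS (leq_trans km).
have -> : (fun w => F (path_sum a n.+1 w) (X n.+1 w)) =
    (fun tz => F (A n.+1 tz.1) tz.2) \o Y.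
  by apply/funext => w; rewrite /= Apath.
have -> : (fun w => chain_op p a F (path_sum a n w) (X n w)) =
    (fun t => chain_op p a F (A n t) (nth x0 t n)) \o path n.
  by apply/funext => w; rewrite /= Apath// nth_path.
rewrite !expectation_finite_valued//; congr (_%:E).
transitivity (\sum_t \sum_z F (A n.+1 t) z * fine (P (Y @^-1` [set (t, z)]))).
  by rewrite pair_bigA/=; apply: eq_bigr => -[t z] _.
apply: eq_bigr => t _; rewrite /chain_op mulr_suml; apply: eq_bigr => z _.
rewrite Ypre (path_preim x0).
have := history_succ n (fun k => if (k <= n)%N then nth x0 t k else z).
rewrite leqnn ltnn.
have -> : history X n (fun k => if (k <= n)%N then nth x0 t k else z) = history X n (nth x0 t).
  by apply/seteqP; split => w h k kn; have := h k kn; rewrite kn.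
by move=> ->; rewrite /A big_nat_recr//= mulrA (mulrC (F _ _)).
Qed.

Lemma expectation_chain d (a : S -> 'cV[R]_d) (F : 'cV[R]_d -> S -> R) n :
  ('E_P[fun w => F (path_sum a n w) (X n w)] =
   (\sum_x pi x * iter n (chain_op p a) F 0 x)%:E)%E.
Proof.
elim: n F => [|n ih] F; last by rewrite expectation_markov_step ih iterSr.
have -> : (fun w => F (path_sum a 0 w) (X 0%N w)) = F 0 \o X 0%N.
  by apply/funext => w; rewrite /path_sum big_nil.
rewrite expectation_finite_valued//; congr (_%:E).
by apply: eq_bigr => x _; rewrite statX/= mulrC.
Qed.

Hypothesis pi_gt0 : forall x, 0 < pi x.

Lemma integral_next (phi : S -> R) x :
  (\int[P]_(w in X 0%N @^-1` [set x]) (phi (X 1%N w))%:E)%E =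
  (pi x * \sum_y p x y * phi y)%:E.
Proof.
rewrite integral_finite_valued//; congr (_%:E); rewrite mulr_sumr; apply: eq_bigr => y _.
have := history_succ 0 (fun k => if k is 0%N then x else y).
have -> : history X 0 (fun k => if k is 0%N then x else y) = X 0%N @^-1` [set x].
  apply/seteqP; split => w /= h; first exact: (h 0%N).
  by move=> k; rewrite leqn0 => /eqP ->.
by move=> ->; rewrite statX/=; ring.
Qed.

Lemma cond_mean_next m n (phi : S -> 'M[R]_(m, n)) x :
  cond_mean P (phi \o X 1%N) (X 0%N @^-1` [set x]) = \sum_y p x y *: phi y.
Proof.
apply/matrixP => i j; rewrite mxE /Rintegral (integral_next (fun y => phi y i j)) statX/=.
rewrite mulrC mulKf ?gt_eqF// summxE.
by apply: eq_bigr => y _; rewrite mxE.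
Qed.

(** On the event X_0 = x the increment m_1 equals V X_1 - P V x. *)
Lemma cond_covE d (V : S -> 'cV[R]_d) x i j :
  cond_cov P X V x i j =
  \sum_y p x y * ((V y - transition_op p V x) i 0 * (V y - transition_op p V x) j 0).
Proof.
rewrite /cond_cov /cond_mean mxE /Rintegral.
rewrite (eq_integral (fun w => ((V (X 1%N w) - transition_op p V x) i 0 *
  (V (X 1%N w) - transition_op p V x) j 0)%:E)).
  rewrite (integral_next (fun y => (V y - transition_op p V x) i 0 * (V y - transition_op p V x) j 0)).
  by rewrite statX/= mulrC mulKf ?gt_eqF.
move=> w; rewrite inE/= => Xw; congr (_%:E).
rewrite mxE big_ord1 [in X in _ * X]mxE /mart_diff/= Xw.
by rewrite (cond_mean_next (n := 1) V).
Qed.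

End chain_law.

(** * Euclidean norms and square roots of matrices *)
Section matrices.
Context (R : realType) (d : nat).

Lemma enorm_le_l1norm (v : 'cV[R]_d) : enorm v <= l1norm v.
Proof.
rewrite -(ger0_norm (l1norm_ge0 v)) -sqrtr_sqr; apply: ler_wsqrtr.
apply: le_trans (dotp_self_le v); rewrite /dotp.
by apply: ler_sum => i _; rewrite expr2.
Qed.

Definition l1opnorm (M : 'M[R]_d) : R := \sum_i \sum_j `|M i j|.

Lemma l1opnorm_ge0 M : 0 <= l1opnorm M.
Proof. by apply: sumr_ge0 => i _; apply: sumr_ge0. Qed.

Lemma l1norm_mulmx (M : 'M[R]_d) v : l1norm (M *m v) <= l1opnorm M * l1norm v.
Proof.
rewrite /l1norm /l1opnorm mulr_suml; apply: ler_sum => i _; rewrite mxE.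
apply: (le_trans (ler_norm_sum _ _ _)); rewrite mulr_suml; apply: ler_sum => j _.
by rewrite normrM ler_wpM2l// coord_le_l1norm.
Qed.

Lemma lip1_lipschitz_l1 h (M : 'M[R]_d) (s : R) : lip1 h ->
  lipschitz_l1 (l1opnorm M * `|s|) (fun v => h (s *: (M *m v))).
Proof.
move=> hl u v; apply: (le_trans (hl _ _)); apply: (le_trans (enorm_le_l1norm _)).
rewrite -scalerBr -mulmxBr l1normZ mulrAC mulrC ler_wpM2r//; exact: l1norm_mulmx.
Qed.

Lemma sqrtmx_unit (A B : 'M[R]_d) : pdmx A -> is_sqrtmx A B -> B \in unitmx.
Proof.
move=> [_ pA] [[BT _] BB]; rewrite -row_free_unit -kermx_eq0; apply/rowV0P => u.
move/sub_kermxP => uB; apply/eqP; apply: contraT => u0.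
have uT0 : u^T != 0 by rewrite -trmx0 (inj_eq trmx_inj).
by have := pA u^T uT0; rewrite trmxK -BB mulmxA uB !mul0mx mxE ltxx.
Qed.

End matrices.

(** * Comparison of rates *)
Section rates.
Context (R : realType).

(** Induction, with ln (1 - 1 / (k + 1)) <= - 1 / (k + 1). *)
Lemma harmonic_le n : (0 < n)%N -> \sum_(k < n) k.+1%:R^-1 <= 1 + ln n%:R :> R.
Proof.
case: n => // n _; elim: n => [|n ih]; first by rewrite big_ord1 invr1 ln1 addr0.
rewrite big_ord_recr/=; apply: (le_trans (lerD ih (lexx _))); rewrite -addrA lerD2l.
have n1 : 0 < n.+1%:R :> R by rewrite ltr0n.
have n2 : 0 < n.+2%:R :> R by rewrite ltr0n.
have q0 : 0 < n.+1%:R / n.+2%:R :> R by rewrite divr_gt0.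
have := le_ln1Dx (x := n.+1%:R / n.+2%:R - 1 : R).
rewrite (_ : 1 + (n.+1%:R / n.+2%:R - 1) = n.+1%:R / n.+2%:R :> R); last by ring.
rewrite ltrBrDl addrN => /(_ q0); rewrite lnM ?posrE ?invr_gt0// lnV ?posrE//.
have -> : n.+1%:R / n.+2%:R - 1 = - n.+2%:R^-1 :> R.
  have -> : n.+1%:R = n.+2%:R - 1 :> R by rewrite -[n.+2%:R]natr1 addrK.
  by rewrite mulrBl divff ?gt_eqF// mul1r; ring.
by set a := ln _; set b := ln _; set c := _^-1 => h; lra.
Qed.

(** For s = (1 - b) / 2 the inequality exp (s l) >= 1 + s l >= s (1 + l) trades the
    logarithm l = ln n for n^s, and n^s / sqrt n = n^(- b / 2). *)
Lemma log_rate_le (b : R) n : 0 < b < 1 -> (0 < n)%N ->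
  (1 + ln n%:R) / Num.sqrt n%:R <= 2 / (1 - b) ^+ 2 * n%:R `^ (- (b / 2)).
Proof.
move=> /andP[b0 b1] n0; have nR : 0 < n%:R :> R by rewrite ltr0n.
have n1 : 1 <= n%:R :> R by rewrite ler1n.
have l0 : 0 <= ln n%:R :> R by rewrite ln_ge0.
rewrite -powR12_sqrt ?ler0n// -powRN /powR gt_eqF//.
set l := ln _ in l0 *; pose s := (1 - b) / 2.
have s0 : 0 < s by rewrite divr_gt0// subr_gt0.
have e1 : s * (1 + l) <= expR (s * l).
  by apply: le_trans (expR_ge1Dx _); rewrite mulrDr mulr1 lerD2r /s; lra.
have e2 : 1 + l <= 2 / (1 - b) * expR (s * l).
  rewrite (_ : 2 / (1 - b) = s^-1) 1?mulrC ?ler_pdivlMr 1?mulrC//.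
  by rewrite /s invf_div.
have -> : expR (- (b / 2) * l) = expR (s * l) * expR (- 2^-1 * l).
  by rewrite -expRD; congr expR; rewrite /s; field.
rewrite mulrA ler_wpM2r ?expR_ge0//; apply: (le_trans e2).
rewrite ler_wpM2r ?expR_ge0// ler_wpM2l// lef_pV2 ?posrE ?exprn_gt0 ?subr_gt0//.
rewrite expr2 ler_piMl; lra.
Qed.

End rates.

(** * The central limit theorem *)
Section main.
Context (R : realType) (d : nat) (S : finType) (p : S -> S -> R) (pi : S -> R)
  (dispX : measure_display) (TX : measurableType dispX)
  (PX : probability TX R) (X : nat -> TX -> S)
  (chainX : markov_chain PX X p) (irr_p : irreducible p)
  (inv_pi : invariant_distribution p pi) (statX : stationary PX X pi)
  (r V : S -> 'cV[R]_d) (poissonV : poisson_solution p pi r V)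
  (Sigma_pd : pdmx (asymptotic_cov PX X pi V))
  (B : 'M[R]_d)
  (BE : is_sqrtmx (asymptotic_cov PX X pi V) B)
  (dispZ : measure_display) (TZ : measurableType dispZ)
  (PZ : probability TZ R) (Z : TZ -> 'cV[R]_d)
  (gaussZ : std_gaussian PZ Z).

Let sp : stochastic p. Proof. by have [] := chainX. Qed.
Let piP : forall x, 0 < pi x. Proof. exact: (invariant_gt0 sp irr_p inv_pi). Qed.
Let uB : B \in unitmx. Proof. exact: (sqrtmx_unit Sigma_pd BE). Qed.
(** Multiplying the increments by the inverse square root of their covariance makes
    the limit law N(0, I); the test functions absorb the matrix [B]. *)
Let A := invmx B.
Let V' x := A *m V x.
Let g x := V' x - transition_op p V' x.

Let xi x y := V y - transition_op p V x.

Lemma whitened_increment x y : V' y - transition_op p V' x = A *m xi x y.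
Proof.
rewrite /xi mulmxBr; congr (_ - _); rewrite /transition_op mulmx_sumr.
by apply: eq_bigr => z _; rewrite scalemxAr.
Qed.

Lemma asymptotic_covE :
  asymptotic_cov PX X pi V = \sum_x pi x *: \sum_y p x y *: (xi x y *m (xi x y)^T).
Proof.
apply: eq_bigr => x _; congr (_ *: _); apply/matrixP => i j.
rewrite (cond_covE chainX statX piP) summxE; apply: eq_bigr => y _.
by rewrite !mxE big_ord1 !mxE.
Qed.

Lemma whitened_cov i j :
  \sum_x pi x * \sum_y p x y * ((V' y - transition_op p V' x) i 0 * (V' y - transition_op p V' x) j 0) =
  (i == j)%:R.
Proof.
have [[BT _] BB] := BE.
have : A *m asymptotic_cov PX X pi V *m A^T = 1%:M.
  rewrite -BB mulmxA mulVmx// mul1mx /A trmx_inv BT mulmxV//.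
move=> /matrixP /(_ i j); rewrite [RHS]mxE => <-.
rewrite asymptotic_covE mulmx_sumr mulmx_suml summxE; apply: eq_bigr => x _.
rewrite -scalemxAr -scalemxAl mxE; congr (_ * _).
rewrite mulmx_sumr mulmx_suml summxE; apply: eq_bigr => y _.
rewrite -scalemxAr -scalemxAl [RHS]mxE; congr (_ * _).
rewrite !whitened_increment !mulmxA -(mulmxA (A *m xi x y)) -trmx_mul [RHS]mxE big_ord1.
by congr (_ * _); rewrite [RHS]mxE.
Qed.

(** By the Poisson equation every summand r - rbar is V - P V. *)
Lemma normalized_sumE n w :
  normalized_sum X pi r n w = (Num.sqrt n%:R)^-1 *: (B *m path_sum X g n w).
Proof.
rewrite /normalized_sum big_add1/=; congr (_ *: _).
rewrite /path_sum mulmx_sumr; apply: eq_bigr => k _.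
by rewrite -poissonV /g whitened_increment mulmxA mulmxV// mul1mx.
Qed.

(** The factor 1 / sqrt n is the Lipschitz constant of v |-> h (B v / sqrt n). *)
Lemma clt_rate : exists C : R, 0 <= C /\ forall n h, (0 < n)%N -> lip1 h ->
  ('E_PX[h \o normalized_sum X pi r n] - 'E_PZ[h \o (fun w => B *m Z w)] <=
   (C * ((1 + ln n%:R) / Num.sqrt n%:R))%:E)%E.
Proof.
have [E hE] := gaussian_expectation_exists R d.
have [C [C0 hC]] := chain_op_gaussian hE sp irr_p inv_pi whitened_cov.
exists (2 * C * l1opnorm B); split; first by rewrite !mulr_ge0// l1opnorm_ge0.
move=> n h n0 hl.
have sn0 : 0 < Num.sqrt n%:R :> R by rewrite sqrtr_gt0 ltr0n.
pose s : R := (Num.sqrt n%:R)^-1.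
have s0 : 0 <= s by rewrite invr_ge0 ltW.
pose h' v := h (s *: (B *m v)).
have L0 : 0 <= l1opnorm B * `|s| by rewrite mulr_ge0// l1opnorm_ge0.
have h'L : lipschitz_l1 (l1opnorm B * `|s|) h' by exact: lip1_lipschitz_l1.
have e1 : ('E_PX[h \o normalized_sum X pi r n] =
    (\sum_x pi x * iter n (chain_op p g) (fun y _ => h' y) 0 x)%:E)%E.
  rewrite -(expectation_chain chainX statX g (fun y _ => h' y) n).
  by congr (expectation PX _); apply/funext => w; rewrite /= normalized_sumE.
have tB : tame (fun v => h (B *m v)).
  apply: (@tame_lipschitz _ _ (l1opnorm B * `|1|)).
    by rewrite mulr_ge0// l1opnorm_ge0.
  by have := lip1_lipschitz_l1 B 1 hl; under eq_fun do rewrite scale1r.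
have e2 : ('E_PZ[h \o (fun w => B *m Z w)] = (E (fun v => h (B *m v)))%:E)%E.
  exact: (gexp_law hE gaussZ tB).
have e3 : E (fun v => h (B *m v)) = E (fun z => h' (Num.sqrt n%:R *: z)).
  congr E; apply/funext => z; rewrite /h' -scalemxAr scalerA /s mulVf ?gt_eqF//.
  by rewrite scale1r.
rewrite e1 e2 e3 -EFinB lee_fin.
have [_ pi1 _] := inv_pi.
set G := E _; have -> : \sum_x pi x * iter n (chain_op p g) (fun y _ => h' y) 0 x - G =
    \sum_x pi x * (iter n (chain_op p g) (fun y _ => h' y) 0 x - G).
  under [RHS]eq_bigr do rewrite mulrBr.
  by rewrite sumrB -mulr_suml pi1 mul1r.
set b := C * (l1opnorm B * `|s|) * (1 + \sum_(k < n) k.+1%:R^-1).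
apply: (@le_trans _ _ b).
  rewrite -[b]mul1r -pi1 mulr_suml; apply: ler_sum => x _.
  rewrite ler_wpM2l ?(ltW (piP x))//; apply: (le_trans (ler_norm _)).
  exact: hC.
have -> : 2 * C * l1opnorm B * ((1 + ln n%:R) / Num.sqrt n%:R) =
    C * (l1opnorm B * `|s|) * (2 * (1 + ln n%:R)) by rewrite ger0_norm// /s; ring.
rewrite /b ler_wpM2l//; first by rewrite mulr_ge0.
have := harmonic_le R n0; have : 0 <= ln n%:R :> R by rewrite ln_ge0// ler1n.
lra.
Qed.

Let dW n := wasserstein PX (normalized_sum X pi r n) PZ (fun w => B *m Z w).

Lemma wasserstein_ge0 n : (0 <= dW n)%E.
Proof.
apply: ereal_sup_ubound; exists (fun=> 0).
  by move=> x y; rewrite subrr normr0 sqrtr_ge0.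
have E0 disp' (T' : measurableType disp') (P' : probability T' R) (Y : T' -> 'cV[R]_d) :
    ('E_P'[(fun=> 0%R) \o Y] = 0)%E by exact: expectation_cst.
by rewrite !E0 sube0.
Qed.

Lemma wasserstein_log_rate : exists C : R, 0 <= C /\ forall n, (0 < n)%N ->
  (dW n <= (C * ((1 + ln n%:R) / Num.sqrt n%:R))%:E)%E.
Proof.
have [C [C0 hC]] := clt_rate; exists C; split=> // n n0.
by apply: ge_ereal_sup => _ [h hl <-]; exact: hC.
Qed.

Lemma wasserstein_power_rate : exists C : R, forall b : R, 0 < b < 1 ->
  forall n : nat, (1 <= n)%N ->
  (dW n <= (C / (1 - b) ^+ 2 * n%:R `^ (- (b / 2)))%:E)%E.
Proof.
have [C [C0 hC]] := wasserstein_log_rate; exists (C * 2) => b b01 n n1.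
apply: (le_trans (hC n n1)); rewrite lee_fin -!mulrA ler_wpM2l// mulrA.
exact: log_rate_le.
Qed.

Lemma wasserstein_bigO :
  (fun n => fine (dW n)) =O_\oo (fun n => ln n%:R ^+ 2 / Num.sqrt n%:R).
Proof.
have [C [C0 hC]] := wasserstein_log_rate.
apply/eqOP; exists (2 * C); split; first exact: num_real.
move=> k Ck; near=> n.
have n1 : (0 < n)%N by near: n; exists 1%N.
have n0 : 0 < n%:R :> R by rewrite ltr0n.
have l1 : 1 <= ln n%:R :> R.
  rewrite -[leLHS]expRK ler_ln ?posrE ?expR_gt0//.
  by near: n; exact: nbhs_infty_ger.
have fd : dW n \is a fin_num.
  rewrite ge0_fin_numE ?wasserstein_ge0//.
  exact: (le_lt_trans (hC n n1) (ltry _)).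
have d1 : fine (dW n) <= C * ((1 + ln n%:R) / Num.sqrt n%:R).
  by rewrite -lee_fin fineK//; exact: hC.
have d0 : 0 <= fine (dW n) by rewrite fine_ge0// wasserstein_ge0.
rewrite ger0_norm// ger0_norm ?divr_ge0 ?sqr_ge0 ?sqrtr_ge0//.
apply: (le_trans d1).
apply: (@le_trans _ _ (2 * C * (ln n%:R ^+ 2 / Num.sqrt n%:R))); last first.
  by rewrite ler_wpM2r ?divr_ge0 ?sqr_ge0 ?sqrtr_ge0// ltW.
rewrite (_ : 2 * C * _ = C * (2 * ln n%:R ^+ 2 / Num.sqrt n%:R)); last by ring.
rewrite ler_wpM2l// ler_wpM2r ?invr_ge0 ?sqrtr_ge0//.
have : ln n%:R <= ln n%:R ^+ 2 :> R by rewrite expr2 ler_peMl// (le_trans _ l1).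
lra.
Unshelve. all: by end_near. Qed.

End main.

Theorem theorem2 (R : realType) (d : nat) (S : finType)
    (p : S -> S -> R) (pi : S -> R)
    (dispX : measure_display) (TX : measurableType dispX)
    (PX : probability TX R) (X : nat -> TX -> S)
    (chainX : markov_chain PX X p) (irr_p : irreducible p)
    (inv_pi : invariant_distribution p pi) (statX : stationary PX X pi)
    (r V : S -> 'cV[R]_d) (poissonV : poisson_solution p pi r V)
    (Sigma_pd : pdmx (asymptotic_cov PX X pi V))
    (Sigma_half : 'M[R]_d)
    (Sigma_halfE : is_sqrtmx (asymptotic_cov PX X pi V) Sigma_half)
    (dispZ : measure_display) (TZ : measurableType dispZ)
    (PZ : probability TZ R) (Z : TZ -> 'cV[R]_d)
    (gaussZ : std_gaussian PZ Z) :
  let dW n := wasserstein PX (normalized_sum X pi r n)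
                          PZ (fun w => Sigma_half *m Z w) in
  (exists C : R, forall beta : R, 0 < beta < 1 -> forall n : nat, (1 <= n)%N ->
     (dW n <= (C / (1 - beta) ^+ 2 * n%:R `^ (- (beta / 2)))%:E)%E) /\
  (* the first part makes dW n finite for n >= 1 *)
  (fun n => fine (dW n)) =O_\oo (fun n => ln n%:R ^+ 2 / Num.sqrt n%:R).
Proof.
move=> dW; split.
  exact: (wasserstein_power_rate chainX irr_p inv_pi statX poissonV Sigma_pd Sigma_halfE gaussZ).
exact: (wasserstein_bigO chainX irr_p inv_pi statX poissonV Sigma_pd Sigma_halfE gaussZ).
Qed.
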